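(* Let $G$ be a finite group and let $G^- = \{ g \in G : \langle g \rangle \text{ is not a maximal cyclic subgroup of } G\}$. If $\langle G^- \rangle < G$ (i.e. the subgroup generated by $G^-$ is proper), then $G/\langle G^- \rangle$ is one of the following: (1) a $p$-group of exponent $p$ for some prime $p$; (2) a Frobenius group whose Frobenius kernel is a $p$-group of exponent $p$ and whose Frobenius complements have order $q$, for some primes $q \neq p$; or (3) isomorphic to $A_5$.
   Context: All groups are finite. A cyclic subgroup $C$ of $G$ is maximal cyclic if there is no cyclic subgroup $D$ of $G$ with $C < D$. *)

(* Defs.v *)
From mathcomp Require Import all_boot all_fingroup all_solvable.
Set Implicit Arguments.
Unset Strict Implicit.
Unset Printing Implicit Defensive.
Local Open Scope group_scope.

Definition max_cyclic (gT : finGroupType) (G C : {set gT}) : bool :=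
  [max C of D | (D \subset G) && cyclic D].

Definition Gminus (gT : finGroupType) (G : {set gT}) : {set gT} :=
  [set g in G | ~~ max_cyclic G <[g]>].

(* Main.v *)
(** If g lies outside <<Gminus G>> and p is a prime divisor of its order, then g^p
generates a proper subgroup of <g>, so g^p lies in Gminus G: every nontrivial
element of the quotient has prime order. Groups G with this property are
classified by induction on the order.

- If G is not simple, let N be a minimal normal subgroup, and suppose first that
  N is a p-group. If x has prime order r, y normalises <x> and the elements of
  the coset <x>y have prime order t and lie outside N, then the norm of any n in
  N under each of these elements vanishes; adding these norms up gives n^r = 1.
  So Sylow r-subgroups have order r for r != p, and if G / N is a Frobenius
  group then its kernel is a p-group. The case |N| = 60 is excluded by the
  Frattini argument.
- If G is simple of even order, a Sylow 2-subgroup S is elementary abelian and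
  TI, and its normaliser has prime index q = |S| - 1 over S. Counting the
  involutions in the cosets of N(S) gives |G| = q (q + 1) (q + 2), and counting
  pairs of involutions according to their product forces q = 3; then N(S) has
  index 5.
- If G is simple of odd order but not a p-group, each prime p dividing |G|
  yields a TI Sylow subgroup P with e = |N(P) : P| > 2, an exceptional
  character chi of G, and a generalised character alpha of norm e + 1 supported
  on the elements of order p. For distinct primes j and k, parity shows that
  '[alpha_k, chi_j] or '[alpha_j, chi_k] is nonzero, and in the first case
  |chi_j|^2 has mean value at least 1 on the elements of order k. Comparing with
  '[chi_j] = 1 and '[alpha_j] = e_j + 1 for the smallest e_j is contradictory. *)

Require Import Defs.
From mathcomp Require Import all_boot all_fingroup all_solvable.
From mathcomp Require Import all_order all_algebra all_field all_character.
From mathcomp Require Import ring lra zify.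
Set Implicit Arguments.
Unset Strict Implicit.
Unset Printing Implicit Defensive.
Local Open Scope group_scope.

(** * Groups all of whose nontrivial elements have prime order *)

Definition prime_orders (gT : finGroupType) (G : {set gT}) :=
  {in G^#, forall x, prime #[x]}.

Definition classified (gT : finGroupType) (G : {group gT}) :=
  [\/ exists2 p, prime p & p.-group G,
      exists p q (K H : {group gT}),
        [/\ prime p, prime q, p != q, [Frobenius G = K ><| H]
          & p.-group K /\ #|H| = q]
    | [/\ simple G, #|G| = 60 & exists2 H : {group gT}, H \subset G & #|G : H| = 5]].

Section PrimeOrders.

Variable gT : finGroupType.
Implicit Types G H K L M N P D : {group gT}.
Implicit Types p q r : nat.

Lemma prime_ordersS (A B : {set gT}) :
  A \subset B -> prime_orders B -> prime_orders A.
Proof. by move=> sAB poB x /(subsetP (setSD _ sAB)); apply: poB. Qed.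

Lemma prime_orders_eq (G : {group gT}) x p :
  prime_orders G -> x \in G -> x ^+ p = 1 -> prime p -> x != 1 -> #[x] = p.
Proof.
move=> poG Gx xp1 p_pr ntx.
have:= order_dvdn x p; rewrite xp1 eqxx => dvdxp.
have:= poG x; rewrite !inE ntx Gx => /(_ isT) px.
by apply/eqP; rewrite -(dvdn_prime2 px p_pr).
Qed.

Lemma prime_orders_commute (G : {group gT}) x y :
    prime_orders G -> x \in G^# -> y \in G^# -> commute x y ->
  #[x] = #[y].
Proof.
move=> poG Gx Gy cxy; have [px py] := (poG x Gx, poG y Gy).
apply/eqP; apply/idPn => ne_xy.
have co_xy: coprime #[x] #[y] by rewrite prime_coprime // dvdn_prime2.
have oxy := orderM cxy co_xy.
have [/setD1P[ntx Gx'] /setD1P[nty Gy']] := (Gx, Gy).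
have: prime #[x * y].
  apply: poG; rewrite !inE groupM // -order_gt1 oxy andbT.
  by rewrite (leq_trans (prime_gt1 px)) // leq_pmulr ?order_gt0.
rewrite oxy => pxy.
have:= @primeP #[x * y]; rewrite oxy => /elimT/(_ pxy)[_ /(_ #[x])].
rewrite dvdn_mulr // => /(_ isT) /orP[/eqP x1|/eqP Dx].
  by rewrite x1 in px.
have:= leq_pmulr #[x] (order_gt0 x).
have: #[x] < #[x] * #[y] by rewrite -{1}[#[x]]muln1 ltn_pmul2l ?order_gt0 ?prime_gt1.
by rewrite -Dx ltnn.
Qed.

Lemma prime_orders_cent1 G x :
  prime_orders G -> x \in G^# -> #[x].-group 'C_G[x].
Proof.
move=> poG Gx; have px := poG x Gx.
apply/pgroupP => q q_pr /(Cauchy q_pr)[y /setIP[Gy cxy] oy].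
rewrite !inE -oy eq_sym; apply/eqP/(prime_orders_commute poG Gx) => //.
  by rewrite !inE Gy andbT -order_gt1 oy prime_gt1.
by have/cent1P := cxy; apply: commute_sym.
Qed.

Lemma prime_orders_pelt G P p x :
  prime_orders G -> P \subset G -> p.-group P -> x \in P -> x != 1 -> #[x] = p.
Proof.
move=> poG sPG pP Px ntx.
have px: prime #[x] by apply: poG; rewrite !inE ntx (subsetP sPG).
have /pgroupP/(_ _ px): p.-group <[x]> by rewrite (pgroupS _ pP) ?cycle_subG.
by rewrite inE => /(_ (dvdnn _))/eqP.
Qed.

Lemma prime_orders_cent_pgroup G P p x :
    prime_orders G -> P \subset G -> p.-group P -> x \in P -> x != 1 ->
  p.-group 'C_G[x].
Proof.
move=> poG sPG pP Px ntx.
have <- := prime_orders_pelt poG sPG pP Px ntx.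
by apply: prime_orders_cent1 => //; rewrite !inE ntx (subsetP sPG).
Qed.

Lemma prime_orders_quotient G N :
  N \subset G -> prime_orders G -> prime_orders (G / N).
Proof.
move=> sNG poG y /setD1P[nty /morphimP[x Nx Gx Dy]].
rewrite Dy in nty *.
have ntx: x != 1 by apply: contraNneq nty => ->; rewrite morph1.
have px: prime #[x] by apply: poG; rewrite !inE ntx.
have: #[coset N x] %| #[x] by rewrite morph_order.
by move/(prime_nt_dvdP px) => ->//; rewrite order_eq1.
Qed.

(* Two normal subgroups of coprime orders would commute elementwise. *)
Lemma prime_orders_normal_coprime M D K p :
    prime_orders M -> D <| M -> K <| M -> D :!=: 1 -> K :!=: 1 ->
  p.-group D -> p^'.-group K -> False.
Proof.
move=> poM nDM nKM /trivgPn[d Dd ntd] /trivgPn[k Kk ntk] pD p'K.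
have [[sDM nDM'] [sKM nKM']] := (andP nDM, andP nKM).
have tiDK: D :&: K = 1 by rewrite coprime_TIg // (pnat_coprime pD p'K).
have cDK: D \subset 'C(K).
  apply/commG1P/trivgP; rewrite -tiDK commg_subI // subsetI ?subxx /=.
    by rewrite (subset_trans sDM).
  by rewrite (subset_trans sKM).
have odk: #[d] = #[k].
  apply: (prime_orders_commute poM); last exact: (centsP cDK).
    by rewrite !inE ntd (subsetP sDM).
  by rewrite !inE ntk (subsetP sKM).
have pk: prime #[k] by apply: poM; rewrite !inE ntk (subsetP sKM).
have od := prime_orders_pelt poM sDM pD Dd ntd.
have := mem_p_elt p'K Kk; rewrite /p_elt -odk od.
by rewrite pnatE ?inE ?eqxx // -od odk.
Qed.

Lemma classified_local M D p :
    prime_orders M -> classified M -> D <| M -> D :!=: 1 -> p.-group D ->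
  exists P : {group gT}, [/\ P <| M, p.-Sylow(M) P, D \subset P
                        & M :=: P \/ prime #|M : P|].
Proof.
move=> poM clM nDM ntD pD; have [p_pr p_dvD _] := pgroup_pdiv pD ntD.
have sDM := normal_sub nDM.
case: clM => [[r r_pr rM] | [s [q [K [H]]]] | [simM oM _]].
- have pr: p = r.
    by have:= pgroupP rM p p_pr (dvdn_trans p_dvD (cardSg sDM)); rewrite inE => /eqP.
  exists M; split; rewrite ?normal_refl //; last by left.
  by rewrite pr pHallE subxx part_pnat_id /=.
- case=> s_pr q_pr s'q frobM [sK oH].
  have [defM ntK ntH ltKM ltHM] := Frobenius_context frobM.
  have [nKM _ _ _ _] := sdprod_context defM.
  have oMK: #|M : K| = q by rewrite -divgS ?normal_sub // -(sdprod_card defM) mulKn // oH.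
  have sp: s = p.
    apply/eqP; apply/idPn=> ne_sp.
    apply: (prime_orders_normal_coprime poM nDM nKM ntD ntK pD).
    by apply: pi_pnat sK _; rewrite !inE.
  have sylK: p.-Sylow(M) K.
    rewrite /pHall normal_sub // -sp sK oMK pnatE // !inE eq_sym.
    exact: s'q.
  exists K; split=> //; last by right; rewrite oMK.
  by rewrite (sub_normal_Hall sylK).
- have [_ /(_ D nDM)[D1|DM]] := simpleP _ simM; first by rewrite D1 eqxx in ntD.
  have: 2 \in \pi(M) /\ 3 \in \pi(M) by rewrite /= !inE oM; split.
  rewrite !mem_primes => -[/and3P[_ _ d2] /and3P[_ _ d3]].
  rewrite DM in pD; have:= pgroupP pD 2 isT d2; have:= pgroupP pD 3 isT d3.
  by rewrite !inE => /eqP <-.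
Qed.

Lemma Frobenius_of_normal_Sylow G P p q :
    prime_orders G -> p.-Sylow(G) P -> P <| G -> P :!=: 1 ->
    prime q -> #|G : P| = q -> 
  exists H : {group gT}, [Frobenius G = P ><| H] /\ #|H| = q.
Proof.
move=> poG sylP nPG ntP q_pr oGP.
have [H] := splitsP (SchurZassenhaus_split (pHall_Hall sylP) nPG).
case/complP=> tiPH defG.
have oH: #|H| = q.
  by rewrite -oGP -divgS ?normal_sub // -defG TI_cardMg // mulKn.
exists H; split=> //.
have sHG: H \subset G by rewrite -defG mulG_subr.
have pP := pHall_pgroup sylP.
apply/prime_FrobeniusP; rewrite ?oH //; split.
  by rewrite sdprodE // (subset_trans sHG) ?normal_norm.
apply/trivgP/subsetP => x /setIP[Px cHx]; rewrite inE; apply/idPn => ntx.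
have pCx := prime_orders_cent_pgroup poG (normal_sub nPG) pP Px ntx.
have: p.-group H.
  apply: pgroupS pCx; rewrite subsetI sHG.
  by rewrite sub_cent1.
move=> pH; have [y Hy nty]: exists2 y, y \in H & y != 1.
  by apply/trivgPn; rewrite -cardG_gt1 oH prime_gt1.
have sHP: H \subset P by rewrite (sub_normal_Hall sylP).
have: y \in P :&: H by rewrite inE Hy (subsetP sHP).
by rewrite tiPH inE (negPf nty).
Qed.

End PrimeOrders.

Section Extensions.

Variable gT : finGroupType.
Implicit Types G H K L M N P D R S Y : {group gT}.
Implicit Types p q r t : nat.

Lemma expMgV_prod (n g : gT) t :
  (n * g^-1) ^+ t = (\prod_(i < t) n ^ (g ^+ i)) * g ^- t.
Proof.
elim: t => [|t IHt]; first by rewrite big_ord0 mul1g invg1.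
by rewrite expgSr IHt big_ord_recr /= conjgE expgS invMg !mulgA mulgK.
Qed.

Lemma expg_coprime_inj (g h : gT) t i :
  prime t -> g ^+ t = 1 -> h ^+ t = 1 -> 0 < i < t -> g ^+ i = h ^+ i -> g = h.
Proof.
move=> t_pr gt ht /andP[i0 it] ghi.
have co_it: coprime i t by rewrite coprime_sym prime_coprime // gtnNdvd.
have tot0: 0 < totient t by rewrite totient_gt0 prime_gt0.
have E: forall z : gT, z ^+ t = 1 -> z = (z ^+ i) ^+ (i ^ (totient t).-1).
  move=> z zt; rewrite -expgM -expnS prednK //.
  rewrite (divn_eq (i ^ _) t) expgD mulnC expgM zt expg1n mul1g.
  by rewrite Euler_exp_totient // modn_small ?prime_gt1.
by rewrite (E g gt) ghi -E.
Qed.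

Lemma prime_orders_notin G H g t :
    prime_orders G -> g \in G -> g \notin H -> prime t -> g ^+ t \in H ->
  #[g] = t.
Proof.
move=> poG Gg notHg t_pr Hgt; have png: prime #[g].
  by apply: poG; apply/setD1P; split=> //; apply: contraNneq notHg => ->.
apply/eqP; rewrite -(dvdn_prime2 png t_pr); apply: contraR notHg.
rewrite -prime_coprime // -generator_coprime => /eqP defC.
by rewrite -cycle_subG defC cycle_subG.
Qed.

Import GRing.Theory FiniteModule.

(* Summing the vanishing norms of n under <g>, for g in the coset <x>y, and
   exchanging the sums leaves only r copies of n: the powers y^i with
   0 < i < t contribute conjugates of the norm of n under <x>. *)
Lemma norm_coset_exponent G N x y n r t :
    prime_orders G -> N <| G -> abelian N -> x \in G -> y \in G ->
    prime r -> #[x] = r -> x \notin N -> y \in 'N(<[x]>) -> prime t ->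
    {in <[x]> :* y, forall g, g ^+ t = 1 /\ g \notin N} -> n \in N ->
  n ^+ r = 1.
Proof.
move=> poG nNG abN Gx Gy r_pr ox notNx nxy t_pr tyP Nn.
have [sNG nNG'] := andP nNG.
have norm0 g s: g \in G -> prime s -> g ^+ s = 1 -> g \notin N ->
    (\sum_(i < s) fmod abN n ^@ (g ^+ i) = 0)%R.
  move=> Gg s_pr gs notNg; apply: val_inj => /=; rewrite fmval_sum.
  have nNg i: g ^+ i \in 'N(N) by rewrite groupX // (subsetP nNG').
  under eq_bigr => i _ do rewrite fmvalJ // fmodK //.
  have := expMgV_prod n g s; rewrite gs invg1 mulg1 => <-.
  have ng_notN: n * g^-1 \notin N by rewrite groupMl // groupV.
  have ong: #[n * g^-1] = s.
    apply: (prime_orders_notin poG) ng_notN s_pr _.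
      by rewrite groupM ?groupV // (subsetP sNG).
    rewrite expMgV_prod gs invg1 mulg1; apply: group_prod => i _.
    by rewrite memJ_norm.
  by rewrite -ong expg_order.
have sub_r z: z \in <[x]> -> z \in G by apply/subsetP; rewrite cycle_subG.
have coset_G z: z \in <[x]> :* y -> z \in G.
  by case/rcosetP=> z0 /sub_r Gz ->; rewrite groupM.
set u := fmod abN n in norm0 *.
have normX: (\sum_(z in <[x]>) u ^@ z = 0)%R.
  have xr: x ^+ r = 1 by rewrite -ox expg_order.
  rewrite -[RHS](norm0 x r) //.
  have ->: <[x]> = [set x ^+ i | i : 'I_r].
    apply/setP=> z; apply/idP/imsetP=> [/cyclePmin[i ltir ->] | [i _ ->]].
      by rewrite ox in ltir; exists (Ordinal ltir).
    exact: mem_cycle.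
  rewrite big_imset //= => i j _ _ /eqP.
  by rewrite eq_expg_mod_order ox !modn_small // => /eqP/val_inj.
have nxR: <[x]> \subset 'N(<[x]>) := normG _.
apply/eqP; rewrite -[n](fmodK abN Nn) -/u -fmvalZ; apply/eqP.
rewrite -[RHS](fmval0 abN); congr (val _).
transitivity (\sum_(g in <[x]> :* y) \sum_(i < t) u ^@ (g ^+ i))%R; last first.
  by apply: big1 => g Rg; have [gt notNg] := tyP g Rg; rewrite norm0 ?coset_G.
rewrite exchange_big /= -(prednK (prime_gt0 t_pr)) big_ord_recl /= [X in (_ + X)%R]big1 ?addr0.
  under eq_bigr do rewrite expg0 actr1.
  by rewrite sumr_const card_rcoset -orderE ox.
move=> i _; rewrite /bump /= add1n; set k := i.+1.
have kt: 0 < k < t by rewrite /k /= -[X in _ < X](prednK (prime_gt0 t_pr)) ltnS.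
have injk: {in <[x]> :* y &, injective (fun g => g ^+ k)}.
  move=> g h Rg Rh /=; have [[gt _] [ht _]] := (tyP g Rg, tyP h Rh).
  exact: expg_coprime_inj t_pr gt ht kt.
have imk: [set g ^+ k | g in <[x]> :* y] = <[x]> :* (y ^+ k).
  apply/eqP; rewrite eqEcard card_in_imset // !card_rcoset leqnn andbT.
  apply/subsetP=> _ /imsetP[g Rg ->].
  have ng: g \in 'N(<[x]>).
    by case/rcosetP: Rg => z Rz ->; rewrite groupM // (subsetP nxR).
  apply/rcoset_kercosetP; rewrite ?groupX // !morphX //; congr (_ ^+ _).
  exact/rcoset_kercosetP.
rewrite -(big_imset (fun h => (u ^@ h)%R) injk) imk -rcosetE big_imset /=; last first.
  by move=> z1 z2 _ _ /mulIg.
transitivity ((\sum_(z in <[x]>) u ^@ z) ^@ (y ^+ k))%R; last by rewrite normX act0r.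
rewrite actr_sum; apply: eq_bigr => z Rz.
by rewrite actrM // (subsetP nNG') ?groupX // sub_r.
Qed.

Lemma norm_pgroup_order G N R p r :
    prime_orders G -> N <| G -> abelian N -> N :!=: 1 -> p.-group N ->
    R \subset G -> r.-group R -> R :!=: 1 -> r != p ->
  #|R| = r.
Proof.
move=> poG nNG abN ntN pN sRG rR ntR r'p.
have [r_pr _ _] := pgroup_pdiv rR ntR; have [p_pr _ _] := pgroup_pdiv pN ntN.
have tiNR: N :&: R = 1.
  by apply/coprime_TIg/(pnat_coprime pN)/(pi_pnat rR); rewrite !inE.
have expR g: g \in R -> g ^+ r = 1.
  move=> Rg; have [->|ntg] := eqVneq g 1; first by rewrite expg1n.
  by rewrite -(prime_orders_pelt poG sRG rR Rg ntg) expg_order.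
have [z /setIP[Rz cRz] ntz]: exists2 z, z \in 'Z(R) & z != 1.
  apply/trivgPn; apply: contraNneq ntR => Z1.
  exact/eqP/(trivg_center_pgroup rR).
have oz := prime_orders_pelt poG sRG rR Rz ntz.
apply/eqP; rewrite -oz eq_sym orderE eqn_leq subset_leq_card ?cycle_subG //=.
rewrite leqNgt; apply/negP => lt_z_R.
have [y Ry notZy]: exists2 y, y \in R & y \notin <[z]>.
  by apply/subsetPn; apply: contraL lt_z_R => /subset_leq_card; rewrite -leqNgt.
have notN g: g \in R -> g != 1 -> g \notin N.
  move=> Rg; apply: contra => Ng; rewrite -in_set1 -[[set 1]]tiNR.
  by rewrite inE Ng.
have [n Nn ntn] := trivgPn _ ntN.
have := prime_orders_pelt poG (normal_sub nNG) pN Nn ntn.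
suffices nr: n ^+ r = 1.
  rewrite (prime_orders_eq poG _ nr r_pr ntn) ?(subsetP (normal_sub nNG)) //.
  exact/eqP.
have [Gz Gy] := (subsetP sRG _ Rz, subsetP sRG _ Ry).
apply: (norm_coset_exponent poG nNG abN Gz Gy r_pr oz (notN _ Rz ntz) _ r_pr _ Nn).
  apply: (subsetP (cent_sub _)); rewrite cent_cycle; apply/cent1P.
  by apply: commute_sym; apply: (centP cRz).
move=> g /rcosetP[w Zw ->]; have Rw: w \in R by apply: subsetP Zw; rewrite cycle_subG.
have Rwy: w * y \in R by rewrite groupM.
split; [exact: expR | apply: notN => //].
by apply: contraNneq notZy => wy1; rewrite -(mulKg w y) wy1 mulg1 groupV.
Qed.

Definition smaller_classified (n : nat) :=
  forall (rT : finGroupType) (K : {group rT}),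
    #|K| < n -> prime_orders K -> classified K.

Lemma classified_p_ext G N p :
    prime_orders G -> N <| G -> abelian N -> N :!=: 1 -> p.-group N ->
    (exists2 r, prime r & r.-group (G / N)) -> classified G.
Proof.
move=> poG nNG abN ntN pN [r r_pr rGN].
have [p_pr _ _] := pgroup_pdiv pN ntN.
have [rp | r'p] := eqVneq r p.
  apply: Or31; exists p => //; rewrite -(pquotient_pgroup pN (normal_norm nNG)).
  by rewrite -rp.
have [R sylR] := Sylow_exists r G; have sRG := pHall_sub sylR.
have sylN: p.-Sylow(G) N.
  rewrite /pHall normal_sub // pN -card_quotient ?normal_norm //=.
  by apply: (pi_pnat rGN); rewrite !inE.
have oGN: #|G : N| = #|R|.
  rewrite (card_Hall sylR) -(LagrangeI G N) (setIidPr (normal_sub nNG)).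
  rewrite partnM ?cardG_gt0 ?indexg_gt0 // -card_quotient ?normal_norm //.
  rewrite (part_pnat_id rGN) part_p'nat ?mul1n //.
  by apply: (pi_pnat pN); rewrite !inE eq_sym.
have [R1 | ntR] := eqVneq R 1%G.
  apply: Or31; exists p => //; rewrite -(pquotient_pgroup pN (normal_norm nNG)).
  by rewrite /pgroup card_quotient ?normal_norm // oGN R1 cards1.
have oR := norm_pgroup_order poG nNG abN ntN pN sRG (pHall_pgroup sylR) ntR r'p.
have [H [frobG oH]] :=
  Frobenius_of_normal_Sylow poG sylN nNG ntN r_pr (etrans oGN oR).
by apply: Or32; exists p, r, N, H; rewrite eq_sym.
Qed.

Lemma prime_index_order G K g t :
    prime_orders G -> K <| G -> prime t -> #|G : K| = t -> g \in G ->
  g \notin K -> #[g] = t.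
Proof.
move=> poG nKG t_pr oGK Gg notKg.
apply: (prime_orders_notin poG Gg notKg t_pr).
have nKg: g \in 'N(K) by apply: subsetP Gg; apply: normal_norm.
apply: coset_idr; first by rewrite groupX.
rewrite morphX // -oGK -card_quotient ?normal_norm //.
by rewrite expg_cardG ?mem_quotient.
Qed.

Lemma classified_Frobenius_ext G N p :
    prime_orders G -> N <| G -> abelian N -> N :!=: 1 -> p.-group N ->
    (exists r t (K H : {group coset_of N}),
        [/\ prime r, prime t, r != t, [Frobenius G / N = K ><| H]
          & r.-group K /\ #|H| = t]) -> classified G.
Proof.
move=> poG nNG abN ntN pN [r [t [Kb [Hb [r_pr t_pr ne_rt frobGb [rKb oHb]]]]]].
have [p_pr _ _] := pgroup_pdiv pN ntN.
have [defGb ntKb _ ltKGb _] := Frobenius_context frobGb.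
have [nKGb _ _ _ _] := sdprod_context defGb.
have [K defKb sNK nKG] := inv_quotientN nNG nKGb.
have sKG := normal_sub nKG.
have oGK: #|G : K| = t.
  have nNG' := normal_norm nNG.
  rewrite -(index_quotient_eq _ sKG nNG') ?(subset_trans (subsetIr _ _)) //.
  by rewrite -defKb -divgS ?normal_sub // -(sdprod_card defGb) mulKn // oHb.
have nNK: K \subset 'N(N) := subset_trans sKG (normal_norm nNG).
have [rp | r'p] := eqVneq r p.
  have pK: p.-group K by rewrite -(pquotient_pgroup pN nNK) -defKb -rp.
  have sylK: p.-Sylow(G) K.
    by rewrite /pHall sKG pK oGK pnatE // !inE -rp eq_sym.
  have ntK: K :!=: 1.
    by apply: contraNneq ntN => K1; rewrite -subG1 -K1.
  have [H [frobG oH]] := Frobenius_of_normal_Sylow poG sylK nKG ntK t_pr oGK.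
  by apply: Or32; exists p, t, K, H; rewrite -[in p != t]rp.
have [R sylR] := Sylow_exists r K; have [sRK rR _] := and3P sylR.
have ntR: R :!=: 1.
  rewrite -cardG_gt1 (card_Hall sylR) p_part_gt1 mem_primes r_pr cardG_gt0 /=.
  have [_ r_dvd _] := pgroup_pdiv rKb ntKb.
  by rewrite (dvdn_trans r_dvd) // defKb dvdn_quotient.
have sRG := subset_trans sRK sKG.
have oR := norm_pgroup_order poG nNG abN ntN pN sRG rR ntR r'p.
have [x Rx ntx] := trivgPn _ ntR.
have ox := prime_orders_pelt poG sRG rR Rx ntx.
have defR: R :=: <[x]>.
  by apply/eqP; rewrite eq_sym eqEcard cycle_subG Rx oR -orderE ox /=.
have [y /setIP[Gy nRy] notKy]: exists2 y, y \in 'N_G(R) & y \notin K.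
  apply/subsetPn; apply/negP => sNK'.
  have defG := Frattini_arg nKG sylR; rewrite mulGSid // in defG.
  by rewrite -defG indexgg in oGK; rewrite -oGK in t_pr.
have notNx: x \notin N.
  apply: contra ntx => Nx; have := prime_orders_pelt poG (normal_sub nNG) pN Nx.
  by rewrite ox => E; apply: contraR r'p => /E ->.
have Gx := subsetP sRG _ Rx.
have [n Nn ntn] := trivgPn _ ntN.
have on := prime_orders_pelt poG (normal_sub nNG) pN Nn ntn.
suffices nr: n ^+ r = 1.
  case/eqP: r'p; rewrite -on.
  by rewrite (prime_orders_eq poG _ nr r_pr ntn) ?(subsetP (normal_sub nNG)).
rewrite defR in nRy.
apply: (norm_coset_exponent poG nNG abN Gx Gy r_pr ox notNx nRy t_pr _ Nn).
move=> g /rcosetP[w]; rewrite -defR => Rw ->.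
have Kw := subsetP sRK _ Rw.
have notKg: w * y \notin K by rewrite groupMl.
split; last by apply: contra notKg; apply: subsetP.
rewrite -(prime_index_order poG nKG t_pr oGK _ notKg) ?expg_order //.
by rewrite groupM // (subsetP sKG).
Qed.

Lemma abelian_Sylow_cent1 G Y p y :
    prime_orders G -> p.-Sylow(G) Y -> abelian Y -> y \in Y -> y != 1 ->
  'C_G[y] = Y.
Proof.
move=> poG sylY abY Yy nty; have [sYG pY _] := and3P sylY.
have pCy := prime_orders_cent_pgroup poG sYG pY Yy nty.
apply/eqP; rewrite eq_sym (sub_pHall sylY pCy) ?subsetIl // subsetI sYG.
by rewrite sub_cent1; apply: (subsetP abY).
Qed.

Lemma abelian_Sylow_TI G Y p :
    prime_orders G -> p.-Sylow(G) Y -> abelian Y -> Y :!=: 1 ->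
  normedTI Y^# G 'N_G(Y).
Proof.
move=> poG sylY abY ntY; have sYG := pHall_sub sylY.
apply/normedTI_memJ_P; split; rewrite ?subsetIl //.
  by rewrite setD_eq0 subG1.
move=> y g /setD1P[nty Yy] Gg; rewrite !(in_setD1, in_setI) conjg_eq1 nty Gg /=.
apply/idP/idP=> [Yyg | nYg]; last by rewrite memJ_norm.
have ntyg: y ^ g != 1 by rewrite conjg_eq1.
apply/normP; rewrite -{1}(abelian_Sylow_cent1 poG sylY abY Yy nty) conjIg.
by rewrite conjGid // -cent1J (abelian_Sylow_cent1 poG sylY abY Yyg ntyg).
Qed.

Lemma simple_TI_norm G Y :
    simple G -> Y :!=: 1 -> Y :!=: G -> normedTI Y^# G 'N_G(Y) ->
  'N_G(Y) != Y.
Proof.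
move=> simG ntY neYG tiY; apply/eqP=> defN; rewrite defN in tiY.
have [K frobG]: {K : {group gT} | [Frobenius G = K ><| Y]}.
  by apply: Frobenius_kernel_exists; apply/andP.
have [defG ntK _ /andP[_ notGK] _] := Frobenius_context frobG.
have [nKG _ _ _ _] := sdprod_context defG.
have [_ /(_ K nKG)[K1 | KG]] := simpleP _ simG.
  by rewrite K1 eqxx in ntK.
by rewrite KG subxx in notGK.
Qed.

(* By Frobenius' theorem: a self-normalising abelian Sylow subgroup would be a
   Frobenius complement. *)
Lemma simple_abelian_Sylow_norm G Y p :
    prime_orders G -> simple G -> p.-Sylow(G) Y -> abelian Y -> Y :!=: 1 ->
    Y :!=: G ->
  'N_G(Y) != Y.
Proof.
move=> poG simG sylY abY ntY neYG.
exact/simple_TI_norm/(abelian_Sylow_TI poG sylY abY ntY).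
Qed.

End Extensions.

Section NonSimple.

Variable gT : finGroupType.
Implicit Types G H K L M N P D R S Y : {group gT}.
Implicit Types p q r t : nat.

Lemma simple60_not_p_ext G N p :
    prime_orders G -> smaller_classified #|G| -> N <| G -> N :!=: 1 ->
    p.-group N -> simple (G / N) -> #|G / N| = 60 -> False.
Proof.
move=> poG IH nNG ntN pN simGb oGb.
have sNG := normal_sub nNG.
have [p_pr _ _] := pgroup_pdiv pN ntN.
have poGb := prime_orders_quotient sNG poG.
have [r [r_pr r'p oGbr]]: exists r, [/\ prime r, r != p & (60`_r)%N = r].
  have [p5 | p'5] := eqVneq p 5; [exists 3; rewrite p5 | exists 5].
    by rewrite p_part.
  by rewrite eq_sym p_part.
have [Y sylY] := Sylow_exists r (G / N); have [sYG rY _] := and3P sylY.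
have oY: #|Y| = r by rewrite (card_Hall sylY) oGb.
have ntY: Y :!=: 1 by rewrite -cardG_gt1 oY prime_gt1.
have abY: abelian Y by apply/cyclic_abelian/prime_cyclic; rewrite oY.
have neYG: Y :!=: G / N.
  by apply: contraTneq r_pr => YG; rewrite -oY YG oGb.
have:= simple_abelian_Sylow_norm poGb simGb sylY abY ntY neYG.
have sHbGb: 'N_(G / N)(Y) \subset G / N := subsetIl _ _.
have [H defH sNH sHG] := inv_quotientS nNG sHbGb; rewrite /= in defH.
have nNH: N <| H := normalS sNH sHG nNG.
have nYH: Y <| H / N by rewrite -defH normalSG.
have ltHG: #|H| < #|G|.
  rewrite ltn_neqAle subset_leq_card // andbT; apply/negP => /eqP oHG.
  have HG: H :=: G by apply/eqP; rewrite eqEcard sHG oHG leqnn.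
  rewrite HG in nYH.
  have [_ /(_ Y nYH)[Y1 | YG]] := simpleP _ simGb.
    by rewrite Y1 eqxx in ntY.
  by rewrite YG eqxx in neYG.
have poH := prime_ordersS sHG poG.
have [P [nPH sylP sNP oHP]] := classified_local poH (IH _ H ltHG poH) nNH ntN pN.
have poHb := prime_orders_quotient sNH poH.
have nPbH: P / N <| H / N by rewrite quotient_normal.
have pPb: p.-group (P / N) by rewrite quotient_pgroup // (pHall_pgroup sylP).
have PN: P / N = 1.
  apply/eqP/idPn => ntPb.
  apply: (prime_orders_normal_coprime poHb nPbH nYH ntPb ntY pPb).
  by apply: pi_pnat rY _; rewrite !inE.
have sPN: P \subset N.
  by rewrite -quotient_sub1 ?PN // (subset_trans (normal_sub nPH)) ?normal_norm.
have defP: P :=: N by apply/eqP; rewrite eqEsubset sPN.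
rewrite defH => /eqP[]; apply/eqP; rewrite eq_sym eqEcard normal_sub //= oY.
rewrite card_quotient ?normal_norm //.
case: oHP => [HP | ]; rewrite -defP; first by rewrite HP indexgg prime_gt0.
have : r %| #|H : P|.
  rewrite defP -card_quotient ?normal_norm // -oY cardSg // normal_sub //.
by move=> r_dv HP_pr; rewrite dvdn_prime2 // in r_dv; rewrite (eqP r_dv).
Qed.

Lemma simple60_normal G N :
    prime_orders G -> smaller_classified #|G| -> N <| G -> simple N ->
    #|N| = 60 -> N :=: G.
Proof.
move=> poG IH nNG simN oN; have [sNG nNG'] := andP nNG.
have poN := prime_ordersS sNG poG.
have idx r: prime r -> (60`_r)%N = r -> r.-nat #|G : N|.
  move=> r_pr oNr.
  have [Y sylY] := Sylow_exists r N; have [sYN rY _] := and3P sylY.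
  have oY: #|Y| = r by rewrite (card_Hall sylY) oN.
  have ntY: Y :!=: 1 by rewrite -cardG_gt1 oY prime_gt1.
  have abY: abelian Y by apply/cyclic_abelian/prime_cyclic; rewrite oY.
  have neYN: Y :!=: N by apply: contraTneq r_pr => YN; rewrite -oY YN oN.
  have neL := simple_abelian_Sylow_norm poN simN sylY abY ntY neYN.
  have sYG := subset_trans sYN sNG.
  set H := 'N_G(Y)%G; have sHG: H \subset G := subsetIl _ _.
  have nYH: Y <| H by rewrite normalSG.
  have ltHG: #|H| < #|G|.
    rewrite ltn_neqAle subset_leq_card // andbT; apply/negP => /eqP oHG.
    have HG: H :=: G by apply/eqP; rewrite eqEcard sHG oHG leqnn.
    rewrite HG in nYH.
    have [_ /(_ Y (normalS sYN sNG nYH))[Y1 | YG]] := simpleP _ simN.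
      by rewrite Y1 eqxx in ntY.
    by rewrite YG eqxx in neYN.
  have poH := prime_ordersS sHG poG.
  have [P [nPH sylP sYP oHP]] := classified_local poH (IH _ H ltHG poH) nYH ntY rY.
  have rP := pHall_pgroup sylP.
  pose L := 'N_N(Y)%G.
  have sLH: L \subset H by rewrite setSI.
  have sYL: Y \subset L by rewrite subsetI sYN normG.
  have notLP: ~~ (L \subset P).
    apply: contra neL => sLP; rewrite eq_sym (sub_pHall sylY _ sYL) ?subsetIl //.
    exact: pgroupS sLP rP.
  have defPL: P * L = H.
    case: oHP => [HP | pr_HP]; first by rewrite -HP sLH in notLP.
    exact: mulg_normal_maximal nPH (p_index_maximal (normal_sub nPH) pr_HP) _ _.
  have ->: #|G : N| = #|H : L|.
    rewrite -(Frattini_arg nNG sylY) -/H indexMg -(indexgI H N); congr #|_ : _|.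
    by rewrite /= setIAC (setIidPr sNG).
  have nPL: L \subset 'N(P) := subset_trans sLH (normal_norm nPH).
  by rewrite -defPL -normC // indexMg (pnat_dvd _ rP) // dvdn_indexg.
have r3: 3.-nat #|G : N| by apply: idx; rewrite ?p_part.
have r5: 5.-nat #|G : N| by apply: idx; rewrite ?p_part.
have: 5^'.-nat #|G : N| by apply: (pi_pnat r3).
move/(pnat_coprime r5); rewrite /coprime gcdnn => /eqP i1.
by apply/eqP; rewrite eqEsubset sNG -indexg_eq1 i1.
Qed.

Lemma classified_not_simple G :
    prime_orders G -> smaller_classified #|G| -> ~~ simple G -> classified G.
Proof.
move=> poG IH nsimG.
have [G1 | ntG] := eqVneq (gval G) 1.
  by apply: Or31; exists 2; rewrite // G1 pgroup1.
have [N minN sNG] := minnormal_exists ntG (normG G).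
have [/andP[ntN nNG] minN'] := mingroupP minN.
have nsNG: N <| G by rewrite /normal sNG.
have ltNG: #|N| < #|G|.
  rewrite ltn_neqAle subset_leq_card // andbT; apply: contra nsimG => /eqP oNG.
  have NG: N :=: G by apply/eqP; rewrite eqEcard sNG oNG leqnn.
  apply/simpleP; split=> // H nHG; have [-> | ntH] := eqVneq (gval H) 1; first by left.
  have := minN' H; rewrite ntH normal_norm //= => /(_ isT).
  by rewrite NG normal_sub // => /(_ isT) ->; right.
have poN := prime_ordersS sNG poG.
have [[p p_pr pN] | [p [q [K [H [p_pr q_pr _ frobN [pK _]]]]]] | [simN oN _]]
  := IH _ N ltNG poN; last first.
- by rewrite (simple60_normal poG IH nsNG simN oN) ltnn in ltNG.
- have [defN ntK _ /andP[_ notKN] _] := Frobenius_context frobN.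
  have [nKN _ _ _ _] := sdprod_context defN.
  have hallK: p.-Hall(N) K.
    rewrite /pHall normal_sub // pK p'natE //.
    have [_ p_dvK _] := pgroup_pdiv pK ntK; rewrite -prime_coprime //.
    apply: coprime_dvdl p_dvK _; apply: Frobenius_ker_coprime.
    exact: FrobeniusWker frobN.
  have nKG: K <| G.
    apply: char_normal_trans nsNG; rewrite -(normal_Hall_pcore hallK nKN).
    exact: pcore_char.
  have := minN' K; rewrite ntK normal_norm // normal_sub // => /(_ isT isT) KN.
  by rewrite -KN subxx in notKN.
have [_ _ abN] := minnormal_solvable minN (subxx N) (pgroup_sol pN).
have {}abN: abelian N := abelem_abelian abN.
have ltGb: #|G / N| < #|G| by rewrite ltn_quotient.
have poGb := prime_orders_quotient sNG poG.
have [pGb | fGb | [simGb oGb _]] := IH _ _ ltGb poGb.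
- exact: classified_p_ext poG nsNG abN ntN pN pGb.
- exact: classified_Frobenius_ext poG nsNG abN ntN pN fGb.
- by case: (simple60_not_p_ext poG IH nsNG ntN pN simGb oGb).
Qed.

End NonSimple.

(** * Simple groups of even order *)

Section Involutions.

Variable gT : finGroupType.
Implicit Types (A G H S : {group gT}) (u v x y : gT).

Lemma exponent2_abelian A : {in A, forall x, x ^+ 2 = 1} -> abelian A.
Proof.
move=> A2; apply/centsP=> x Ax y Ay; have inv z: z \in A -> z^-1 = z.
  by move/A2=> z2; apply/eqP; rewrite eq_invg_mul -[z * z]/(z ^+ 2) z2.
by rewrite /commute -[x * y]inv ?groupM // invMg !inv.
Qed.

Lemma order2_inv u : #[u] = 2 -> u^-1 = u.
Proof.
by move=> ou; apply/eqP; rewrite eq_invg_mul -[u * u]/(u ^+ 2) -ou expg_order.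
Qed.

Lemma order2_mul u : #[u] = 2 -> u * u = 1.
Proof. by move=> ou; rewrite -{1}(order2_inv ou) mulVg. Qed.

(* The map x |-> x^-1 x^u is injective on A, hence onto. *)
Lemma fixfree_involution_inverts A u :
    #[u] = 2 -> u \in 'N(A) -> 'C_A[u] = 1 -> {in A, forall x, x ^ u = x^-1}.
Proof.
move=> ou nAu regu; have uu z: (z ^ u) ^ u = z by rewrite -conjgM order2_mul ?conjg1.
have injf: {in A &, injective (fun x => x^-1 * x ^ u)}.
  move=> x y Ax Ay /= exy; apply/eqP; rewrite eq_mulgV1 -in_set1 -[[set 1]]regu.
  rewrite inE groupM ?groupV //=; apply/cent1P.
  have xu: x ^ u = x * y^-1 * y ^ u by rewrite -mulgA -exy mulKVg.
  by apply/commgP/conjg_fixP; rewrite conjMg conjVg xu mulgK.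
have imf: [set x^-1 * x ^ u | x in A] = A.
  apply/eqP; rewrite eqEcard card_in_imset // leqnn andbT.
  by apply/subsetP=> _ /imsetP[x Ax ->]; rewrite groupM ?groupV ?memJ_norm.
move=> x; rewrite -{1}imf => /imsetP[y Ay ->].
by rewrite [RHS]invMg invgK conjMg conjVg uu.
Qed.

Lemma inverted_abelian A u : {in A, forall x, x ^ u = x^-1} -> abelian A.
Proof.
move=> invA; apply/centsP=> x Ax y Ay; apply: invg_inj.
by rewrite -invA ?groupM // conjMg !invA // invMg.
Qed.

Lemma mul_involutions_conj u v : #[u] = 2 -> #[v] = 2 -> (u * v) ^ u = (u * v)^-1.
Proof.
by move=> ou ov; rewrite invMg !order2_inv // conjgE order2_inv // !mulgA order2_mul // mul1g.
Qed.

Lemma involutions_odd_conj u v k :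
  #[u] = 2 -> #[v] = 2 -> #[u * v] = k.*2.+1 -> u ^ ((u * v) ^+ k.+1) = v.
Proof.
move=> ou ov ow; set w := u * v in ow *.
have wu: w ^ u = w^-1 := mul_involutions_conj ou ov.
have E: (w ^+ k.+1)^-1 * u = u * w ^+ k.+1.
  by rewrite conjgC conjVg conjXg wu expgVn invgK.
rewrite conjgE mulgA E -mulgA -expgD addnS addSn addnn expgS -ow expg_order mulg1.
by rewrite /w mulgA order2_mul // mul1g.
Qed.

Lemma involutions_mul_order2 u v :
  #[u] = 2 -> #[v] = 2 -> #[u * v] = 2 -> commute u v.
Proof.
by move=> ou ov ow; rewrite /commute -[LHS]order2_inv // invMg !order2_inv.
Qed.

Lemma involutions_conj G u v :
    prime_orders G -> simple G -> ~~ 2.-group G -> u \in G -> v \in G ->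
    #[u] = 2 -> #[v] = 2 -> v \in u ^: G.
Proof.
move=> poG simG not2G Gu Gv ou ov; apply: contraR not2G => not_uv.
have cuv g: g \in G -> commute u (v ^ g).
  move=> Gg; have ovg: #[v ^ g] = 2 by rewrite orderJ.
  have [w1 | ntw] := eqVneq (u * v ^ g) 1.
    case/imsetP: not_uv; exists g^-1; rewrite ?groupV //.
    by rewrite -[u](mulgK (v ^ g)) w1 mul1g -conjVg order2_inv // conjgK.
  have pw: prime #[u * v ^ g] by apply: poG; rewrite !inE ntw groupM ?groupJ.
  have [ow | oddw] := even_prime pw; first exact: involutions_mul_order2.
  case/imsetP: not_uv; exists ((u * v ^ g) ^+ (#[u * v ^ g])./2.+1 * g^-1).
    by apply: groupM; rewrite ?groupV // groupX // groupM // groupJ.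
  rewrite conjgM (involutions_odd_conj ou ovg) ?conjgK //.
  by rewrite -[LHS]odd_double_half oddw.
have ntv: v != 1 by rewrite -order_gt1 ov.
have nKG: <<v ^: G>> <| G.
  by rewrite /normal gen_subG class_subG //= norms_gen ?class_norm.
have [_ /(_ _ nKG)[K1 | KG]] := simpleP _ simG.
  have: v \in <<v ^: G>> by rewrite mem_gen ?class_refl.
  by rewrite K1 inE (negPf ntv).
have cuG: 'C_G[u] = G.
  apply/setIidPl; rewrite -{1}KG gen_subG; apply/subsetP=> _ /imsetP[g Gg ->].
  by apply/cent1P; apply: commute_sym; apply: cuv.
rewrite -cuG -ou; apply: prime_orders_cent1 => //.
by rewrite !inE Gu andbT -order_gt1 ou.
Qed.

End Involutions.

Section SimpleLocal.

Variables (gT : finGroupType) (G : {group gT}).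
Hypotheses (poG : prime_orders G) (simG : simple G).
Hypothesis smallG : smaller_classified #|G|.

Lemma simple_norm_proper (K : {group gT}) :
  K \subset G -> K :!=: 1 -> K :!=: G -> #|'N_G(K)| < #|G|.
Proof.
move=> sKG ntK neKG; rewrite ltn_neqAle subset_leq_card ?subsetIl // andbT.
apply/negP=> /eqP oN.
have NG: 'N_G(K) = G by apply/eqP; rewrite eqEcard subsetIl oN leqnn.
have nKG: K <| G by rewrite /normal sKG -{1}NG subsetIr.
have [_ /(_ K nKG)[K1 | KG]] := simpleP _ simG.
  by rewrite K1 eqxx in ntK.
by rewrite KG eqxx in neKG.
Qed.

Lemma simple_norm_local (K : {group gT}) (p : nat) :
    K \subset G -> K :!=: 1 -> K :!=: G -> p.-group K ->
  exists P : {group gT}, [/\ P <| 'N_G(K), p.-Sylow('N_G(K)) P, K \subset P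
                        & 'N_G(K) = P \/ prime #|'N_G(K) : P|].
Proof.
move=> sKG ntK neKG pK.
have ltN := simple_norm_proper sKG ntK neKG.
have poN: prime_orders 'N_G(K)%G := prime_ordersS (subsetIl _ _) poG.
have nKN: K <| 'N_G(K)%G by rewrite normalSG.
exact: classified_local poN (smallG ltN poN) nKN ntK pK.
Qed.

End SimpleLocal.

Section SylowCount.

Local Open Scope nat_scope.

Lemma sylow_count_dvd (q f g k m n : nat) :
    0 < q -> 0 < g -> f = (g * q)%N -> n = (1 + q.+1 * (2 * f - 1))%N ->
    m = (k * q).+1 -> (f * q * 2 * m = n * (q.+1 * q))%N ->
  q %| 1.
Proof.
move=> q0 g0 -> -> ->.
have [a Da]: exists a, 2 * g = a.+1 by exists (2 * g).-1; rewrite prednK ?muln_gt0.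
have Dgq: 2 * (g * q) = a.+1 * q by rewrite mulnA Da.
have -> : g * q * q * 2 = a.+1 * q * q by rewrite -Dgq; lia.
rewrite Dgq => E.
have E1: q * (q * (a.+1 * (k * q).+1)) = q * (q * ((a.+1 * q + a) * q.+1)).
  have aq: 0 < a.+1 * q by rewrite muln_gt0.
  have [b Db]: exists b, a.+1 * q = b.+1 by exists (a.+1 * q).-1; rewrite prednK.
  move: E; rewrite Db subn1 /= => E.
  nia.
move/eqP: E1; rewrite !eqn_pmul2l // => /eqP E2.
have E3 : a.+1 * k * q + 1 = (a.+1 * q + a + a.+1) * q by nia.
have: q %| a.+1 * k * q + 1 by rewrite E3 dvdn_mull.
by rewrite dvdn_addr // dvdn_mull.
Qed.

Lemma order_count (q a b m : nat) :
  0 < q -> q * 2 * m = b * (a * q) -> 2 * (q.-1 * m) = q.-1 * (a * b).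
Proof.
move=> q0 Em; have {}Em: q * (2 * m) = q * (a * b) by lia.
by move/eqP: Em; rewrite eqn_pmul2l // => /eqP Em; rewrite mulnCA Em.
Qed.

Lemma pairs_count (q i Q O s : nat) :
    0 < q -> i = q.+2 * q -> 2 * Q = q.-1 * (q.+1 * q.+2) ->
    q.+2 * (q.+1 * q) = (i + Q + O).+1 -> i * i <= i + (i * q.-1 + (Q * q + s)) ->
  q.+2 * O <= s.
Proof.
case: q => // p _ -> /= EQ EG; rewrite -(leq_pmul2l (isT : 0 < 2)) => le_i.
rewrite -(leq_pmul2l (isT : 0 < 2)).
have EO : 2 * O = 2 * (p.+3 * (p.+2 * p.+1)) - 2 - 2 * (p.+3 * p.+1) - p * (p.+2 * p.+3).
  by rewrite EG -EQ; lia.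
nia.
Qed.

Lemma pairs_count3 (q i Q O : nat) :
    0 < q -> i = q.+2 * q -> 2 * Q = q.-1 * (q.+1 * q.+2) ->
    q.+2 * (q.+1 * q) = (i + Q + O).+1 -> q.+2 * O <= i * q.+1 ->
  q <= 1.
Proof.
case: q => // p _ -> /= EQ EG le_O.
have: 2 * (p.+3 * O) <= 2 * (p.+3 * (p.+1 * p.+2)) by nia.
rewrite leq_pmul2l // leq_pmul2l // => {}le_O.
nia.
Qed.

Lemma dvd3_count (q : nat) : 3 %| q.+2 * (q.+1 * q).
Proof.
have: q = q %/ 3 * 3 + q %% 3 := divn_eq q 3.
have: q %% 3 < 3 by rewrite ltn_mod.
case: (q %% 3) => [|[|[|//]]] _ ->.
- by rewrite addn0 mulnA mulnA dvdn_mull.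
- by apply: dvdn_mulr; rewrite -addnS -addnS dvdn_addr ?dvdn_mull.
- by apply/dvdn_mull/dvdn_mulr; rewrite -addnS dvdn_addr ?dvdn_mull.
Qed.

End SylowCount.

Section EvenSimple.

Variables (gT : finGroupType) (G : {group gT}).
Hypotheses (poG : prime_orders G) (simG : simple G).
Hypothesis smallG : smaller_classified #|G|.
Hypotheses (evenG : 2 %| #|G|) (not2G : ~~ 2.-group G).
Variable S : {group gT}.
Hypothesis sylS : 2.-Sylow(G) S.

Local Notation I := [set u in G | #[u] == 2].
Local Notation H := 'N_G(S)%G.
Local Notation q := #|H : S|.

Let sSG : S \subset G := pHall_sub sylS.
Let S2 : 2.-group S := pHall_pgroup sylS.
Let sHG : H \subset G := subsetIl _ _.
Let nSH : S <| H. Proof. by rewrite normalSG. Qed.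
Let sSH : S \subset H := normal_sub nSH.

Let ntS : S :!=: 1.
Proof.
rewrite -cardG_gt1 (card_Hall sylS) p_part_gt1 mem_primes /= cardG_gt0.
exact: evenG.
Qed.

Let neSG : S :!=: G.
Proof. by apply: contraNneq not2G => <-. Qed.

Lemma even_order2 u : u \in S -> u != 1 -> #[u] = 2.
Proof. exact: prime_orders_pelt poG sSG S2. Qed.

Lemma even_abelian : abelian S.
Proof.
apply: exponent2_abelian => x Sx; have [->|ntx] := eqVneq x 1; first exact: expg1n.
by rewrite -(even_order2 Sx ntx) expg_order.
Qed.

Lemma even_cent1 u : u \in S -> u != 1 -> 'C_G[u] = S.
Proof. exact: abelian_Sylow_cent1 poG sylS even_abelian. Qed.

Lemma even_TI : normedTI S^# G H.
Proof. exact: abelian_Sylow_TI poG sylS even_abelian ntS. Qed.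

Lemma even_index_prime : prime q.
Proof.
have [P [nPH sylP sSP]] := simple_norm_local poG simG smallG sSG ntS neSG S2.
have PS: P :=: S.
  apply/eqP; rewrite eq_sym (sub_pHall sylS (pHall_pgroup sylP)) //.
  exact: subset_trans (normal_sub nPH) sHG.
rewrite PS; case=> // HS.
by case/eqP: (simple_abelian_Sylow_norm poG simG sylS even_abelian ntS neSG).
Qed.

Lemma even_invol_conj u v : u \in I -> v \in I -> v \in u ^: G.
Proof.
by rewrite !inE => /andP[Gu /eqP ou] /andP[Gv /eqP ov]; apply: involutions_conj.
Qed.

Lemma even_invol_S u : u \in S -> u != 1 -> u \in I.
Proof. by move=> Su ntu; rewrite inE (subsetP sSG) //= even_order2. Qed.

Lemma even_card_S : #|S| = q.+1.
Proof.
have [u Su ntu] := trivgPn _ ntS.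
have [_ _ tiS] := normedTI_memJ_P even_TI; have S1u: u \in S^# by rewrite !inE ntu.
have orbS: u ^: H = S^#.
  apply/setP=> v; apply/imsetP/idP=> [[g Hg ->] | /setD1P[ntv Sv]].
    by rewrite tiS // (subsetP sHG).
  have /imsetP[g Gg Dv] := even_invol_conj (even_invol_S Su ntu) (even_invol_S Sv ntv).
  by exists g => //; rewrite -(tiS u g) // -Dv !inE ntv.
rewrite (cardsD1 1 S) group1 -orbS -index_cent1.
suffices ->: 'C_H[u] = S by [].
have cS := even_cent1 Su ntu; apply/eqP; rewrite eqEsubset subsetI sSH /=.
by have:= setSI 'C[u] sHG; have:= subsetIr G 'C[u]; rewrite cS => -> ->.
Qed.

Lemma even_card_H : #|H| = (q.+1 * q)%N.
Proof. by rewrite -even_card_S Lagrange. Qed.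

Lemma even_card_G : #|G| = (#|G : H| * (q.+1 * q))%N.
Proof. by rewrite -even_card_H mulnC Lagrange. Qed.

Lemma even_card_I : #|I| = (#|G : H| * q)%N.
Proof.
have [u Su ntu] := trivgPn _ ntS; have Iu := even_invol_S Su ntu.
have ->: I = u ^: G.
  apply/setP=> v; apply/idP/idP=> [|/imsetP[g Gg ->]]; first exact: even_invol_conj.
  by move: Iu; rewrite !inE orderJ => /andP[Gu ->]; rewrite groupJ.
by rewrite -index_cent1 even_cent1 // -(Lagrange_index sHG sSH).
Qed.

Lemma even_q_odd : odd q.
Proof.
have: 2^'.-nat #|G : S| by case/and3P: sylS.
rewrite -(Lagrange_index sHG sSH) pnatM => /andP[_].
by rewrite p'natE // dvdn2 negbK.
Qed.

Lemma even_HI : H :&: I = S^#.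
Proof.
apply/setP=> x; apply/setIP/setD1P=> [[Hx] | [ntx Sx]]; last first.
  by rewrite even_invol_S // (subsetP sSH).
rewrite inE => /andP[Gx /eqP ox]; split; first by rewrite -order_gt1 ox.
have sylSH: 2.-Sylow(H) S := pHall_subl sSH sHG sylS.
by rewrite (mem_normal_Hall sylSH) // /p_elt ox.
Qed.

Lemma even_capJ g : g \in G -> g \notin H -> #|H :&: H :^ g| %| q.
Proof.
move=> Gg notHg; pose D := (H :&: H :^ g)%G; rewrite -[#|_|]/#|D|.
have coDS: coprime #|D| #|S|.
  rewrite coprime_sym -[#|S|]/(#|gval S|) (pnat_coprime S2) // p'natE //.
  apply/negP=> /(@Cauchy _ 2 D isT)[x /setIP[Hx]]; rewrite mem_conjg => Hxg ox.
  have Ix: x \in I by rewrite inE ox (subsetP sHG).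
  have Sx: x \in S^# by rewrite -even_HI inE Hx.
  have Gg' : g^-1 \in G by rewrite groupV.
  have Sxg: x ^ g^-1 \in S^#.
    by rewrite -even_HI inE Hxg inE groupJ ?orderJ ?ox // (subsetP sHG).
  have [_ _ tiS] := normedTI_memJ_P even_TI.
  by move: Sxg; rewrite tiS // groupV (negPf notHg).
have: #|D| %| #|H| by rewrite cardSg ?subsetIl.
by rewrite -(Lagrange sSH) Gauss_dvdr.
Qed.

Lemma even_invol_coset g u : u \in G -> u \notin H -> u \in I -> u \in H :* g ->
  #|[set x in I | H :* x == H :* g]| <= #|H :&: H :^ u|.
Proof.
move=> Gu notHu Iu Hgu; have ou: #[u] = 2 by move: Iu; rewrite inE => /andP[_ /eqP].
rewrite -(card_imset _ (@mulIg _ u)) subset_leq_card //.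
apply/subsetP=> _ /imsetP[x /setIdP[Ix /eqP eHx] ->].
have ox: #[x] = 2 by move: Ix; rewrite inE => /andP[_ /eqP].
have Hxu: x * u \in H.
  have: x \in H :* u by rewrite (rcoset_eqP Hgu) -eHx rcoset_refl.
  by rewrite mem_rcoset order2_inv.
rewrite inE Hxu mem_conjg order2_inv // conjgE order2_inv // -(mulgA x).
by rewrite order2_mul // mulg1 -groupV invMg !order2_inv.
Qed.

Lemma even_coset_eq g : g \in G -> g \notin H ->
  #|[set x in I | H :* x == H :* g]| = q.
Proof.
move=> Gg notHg.
pose c (A : {set gT}) := #|[set x in I | H :* x == A]|.
have HrG : H :* 1 \in rcosets H G by rewrite -rcosetE imset_f.
have cH: c (H :* 1) = q.
  have -> : q = #|S^#| by apply/eqP; rewrite -eqSS -even_card_S (cardsD1 1 S) group1.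
  rewrite -even_HI /c; congr #|pred_of_set _|; apply/setP=> x.
  rewrite in_setI in_set rcoset1 andbC; congr (_ && _).
  by apply/eqP/idP=> [<- | /rcoset_id //]; apply: rcoset_refl.
have sumI: \sum_(A in rcosets H G) c A = #|I|.
  rewrite -sum1_card (partition_big (fun x => H :* x) (mem (rcosets H G))) /=.
    apply: eq_bigr => A _; rewrite /c -sum1_card; apply: eq_bigl => x.
    by rewrite !inE.
  by move=> x; rewrite inE -rcosetE => /andP[Gx _]; apply: imset_f.
have le_c A: A \in rcosets H G -> A != H :* 1 -> c A <= q ?= iff (c A == q).
  case/rcosetsP=> x Gx -> neHx; apply: leqif_eq.
  have [c0 | /set0Pn[u]] := eqVneq [set y in I | H :* y == H :* x] set0.
    by rewrite /c c0 cards0.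
  rewrite inE => /andP[Iu /eqP eHu].
  have Gu: u \in G by move: Iu; rewrite inE => /andP[].
  have Hxu: u \in H :* x by rewrite -eHu rcoset_refl.
  have notHu: u \notin H.
    by apply: contra neHx => Hu; rewrite -eHu rcoset1 rcoset_id.
  apply: leq_trans (even_invol_coset Gu notHu Iu Hxu) _.
  by rewrite dvdn_leq ?even_capJ // prime_gt0 ?even_index_prime.
have := leqif_sum (P := fun A => (A \in rcosets H G) && (A != H :* 1))
   (fun A PA => le_c A (proj1 (andP PA)) (proj2 (andP PA))).
case=> _; rewrite sum_nat_const.
have -> : \sum_(A | (A \in rcosets H G) && (A != H :* 1)) c A
   = (#|[pred A | (A \in rcosets H G) && (A != H :* 1)]| * q)%N.
  apply/eqP; rewrite -(eqn_add2l (c (H :* 1))) -(bigD1 _ HrG) sumI even_card_I.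
  rewrite cH -mulSn /indexg (cardD1 (H :* 1) (mem (rcosets H G))) HrG add1n.
  by apply/eqP; congr (_.+1 * _)%N; apply: eq_card => A; rewrite !inE andbC.
have HgG : H :* g \in rcosets H G by rewrite -rcosetE imset_f.
have neHg: H :* g != H :* 1.
  by apply: contra notHg => /eqP; rewrite rcoset1 => <-; apply: rcoset_refl.
rewrite eqxx => /esym/forall_inP/(_ (H :* g)) c_q; apply/eqP; apply: c_q.
by rewrite HgG.
Qed.

Lemma even_invol_in_coset g : g \in G -> g \notin H ->
  exists2 u, u \in I & u \in H :* g.
Proof.
move=> Gg notHg; have := even_coset_eq Gg notHg.
have := prime_gt0 even_index_prime => q0 cq.
have /set0Pn[u]: [set x in I | H :* x == H :* g] != set0 by rewrite -card_gt0 cq.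
by rewrite inE => /andP[Iu /eqP eHu]; exists u; rewrite // -eHu rcoset_refl.
Qed.

Lemma even_capJ_card g : g \in G -> g \notin H -> #|H :&: H :^ g| = q.
Proof.
move=> Gg notHg; apply/eqP; rewrite eqn_leq; apply/andP; split.
  by rewrite dvdn_leq ?even_capJ // prime_gt0 ?even_index_prime.
have [u Iu Hgu] := even_invol_in_coset Gg notHg.
have Gu: u \in G by move: Iu; rewrite inE => /andP[].
have [h Hh Du] := rcosetP Hgu.
have notHu: u \notin H by rewrite Du groupMl.
have eHgu: H :^ u = H :^ g by rewrite Du conjsgM conjGid.
by have:= even_invol_coset Gu notHu Iu Hgu; rewrite even_coset_eq // eHgu.
Qed.

Lemma even_invol_outside : exists2 u, u \in I & u \notin H.
Proof.
have [g Gg notHg]: exists2 g, g \in G & g \notin H.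
  apply/subsetPn; apply: contraL (simple_norm_proper simG sSG ntS neSG) => sGH.
  by rewrite -leqNgt subset_leq_card.
have [u Iu Hgu] := even_invol_in_coset Gg notHg; exists u => //.
by have [h Hh ->] := rcosetP Hgu; rewrite groupMl.
Qed.

Section OuterInvolution.

Variable u : gT.
Hypotheses (Iu : u \in I) (notHu : u \notin H).

Let D := (H :&: H :^ u)%G.
Let R := 'C_G(D)%G.
Let Gu : u \in G. Proof. by move: Iu; rewrite inE => /andP[]. Qed.
Let ou : #[u] = 2. Proof. by move: Iu; rewrite inE => /andP[_ /eqP]. Qed.
Let q_pr : prime q := even_index_prime.
Let oD : #|D| = q := even_capJ_card Gu notHu.
Let sDH : D \subset H := subsetIl _ _.
Let sDG : D \subset G := subset_trans sDH sHG.
Let qD : q.-group D. Proof. by rewrite /pgroup oD pnat_id. Qed.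
Let ntD : D :!=: 1. Proof. by rewrite -cardG_gt1 oD prime_gt1. Qed.
Let nDu : u \in 'N(D).
Proof. by apply/normP; rewrite /= conjIg -conjsgM order2_mul // conjsg1 setIC. Qed.
Let abD : abelian D. Proof. by apply/cyclic_abelian/prime_cyclic; rewrite oD. Qed.
Let sDR : D \subset R. Proof. by rewrite subsetI sDG. Qed.

Let q_neq2 : q != 2.
Proof. by apply: contraTneq even_q_odd => ->. Qed.

Lemma even_outer_inverts (K : {group gT}) :
  K \subset G -> q.-group K -> u \in 'N(K) -> {in K, forall x, x ^ u = x^-1}.
Proof.
move=> sKG qK nKu; apply: fixfree_involution_inverts => //.
apply/trivgP/subsetP=> x /setIP[Kx /cent1P cxu]; rewrite inE.
apply/idPn=> ntx; case/eqP: q_neq2.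
rewrite -(prime_orders_pelt poG sKG qK Kx ntx) -ou.
apply: (prime_orders_commute poG) => //; first by rewrite !inE ntx (subsetP sKG).
by rewrite !inE Gu andbT -order_gt1 ou.
Qed.

Let qR : q.-group R.
Proof.
have [x Dx ntx] := trivgPn _ ntD.
apply: pgroupS (prime_orders_cent_pgroup poG sDG qD Dx ntx).
by apply: setIS; rewrite /= -cent_set1 centS ?sub1set.
Qed.

Let nRu : u \in 'N(R).
Proof. by apply/normP; rewrite /= conjIg conjGid // -centJ (normP nDu). Qed.

Let sRG : R \subset G := subsetIl _ _.

Let abR : abelian R.
Proof. by have := even_outer_inverts sRG qR nRu; apply: inverted_abelian. Qed.

Lemma even_outer_norm (E : {group gT}) :
    D \subset E -> E \subset R -> u \in 'N(E) ->
  q.-Sylow('N_G(E)) R /\ #|'N_G(E)| = (#|R| * 2)%N.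
Proof.
move=> sDE sER nEu; have sEG := subset_trans sER sRG.
have qE := pgroupS sER qR.
have ntE: E :!=: 1 by apply: contraNneq ntD => E1; rewrite -subG1 -E1.
have neEG: E :!=: G.
  apply: contraNneq q_neq2 => EG; rewrite eq_sym.
  by have:= pgroupP qE 2 isT; rewrite EG => /(_ evenG).
have [P [nPN sylP sEP oNP]] := simple_norm_local poG simG smallG sEG ntE neEG qE.
have sPN := normal_sub nPN; have sPG := subset_trans sPN (subsetIl _ _).
have Nu: u \in 'N_G(E) by rewrite inE Gu.
have nPu: u \in 'N(P) := subsetP (normal_norm nPN) _ Nu.
have qP := pHall_pgroup sylP.
have abP := inverted_abelian (even_outer_inverts sPG qP nPu).
have PR: P :=: R.
  apply/eqP; rewrite eqEsubset; apply/andP; split.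
    rewrite subsetI sPG /= (subset_trans abP) // centS //.
    exact: subset_trans sDE sEP.
  rewrite (sub_normal_Hall sylP) // subsetI sRG.
  by rewrite (subset_trans abR) // (subset_trans (centS sER)) ?cent_sub.
rewrite -PR; split=> //; case: oNP => [NP | NP_pr].
  rewrite NP in Nu; case/eqP: q_neq2.
  have ntu: u != 1 by rewrite -order_gt1 ou.
  by rewrite -ou (prime_orders_pelt poG sPG qP Nu ntu).
rewrite -(Lagrange sPN); congr (_ * _)%N.
rewrite -ou (prime_index_order _ nPN NP_pr) //.
  by apply: prime_ordersS poG; apply: subsetIl.
apply: contra q_neq2 => Pu; have ntu: u != 1 by rewrite -order_gt1 ou.
by rewrite -ou (prime_orders_pelt poG sPG qP Pu ntu).
Qed.

Lemma even_outer_Sylow : q.-Sylow(G) R.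
Proof. by rewrite -Sylow_subnorm; case: (even_outer_norm sDR (subxx R) nRu). Qed.

Lemma even_outer_Sylow_mod : #|G : 'N_G(R)| %% q = 1%N.
Proof. by rewrite -(card_Syl even_outer_Sylow) card_Syl_mod. Qed.

Let oHD : #|H : D| = q.+1.
Proof.
by apply/eqP; rewrite -(eqn_pmul2l (cardG_gt0 D)) Lagrange // oD even_card_H mulnC.
Qed.

Lemma even_outer_sylH : q.-Sylow(H) D.
Proof. by rewrite /pHall sDH qD oHD p'natE // -prime_coprime // coprimenS. Qed.

Lemma even_outer_normH : 'N_H(D) = D.
Proof.
have sDN: D \subset 'N_H(D) by rewrite subsetI sDH normG.
apply/eqP; rewrite eq_sym eqEcard sDN oD.
have tiSN: S :&: 'N_H(D) = 1.
  apply/trivgP/subsetP=> x /setIP[Sx /setIP[Hx nDx]]; rewrite inE.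
  apply/idPn => ntx; have [y Dy nty] := trivgPn _ ntD.
  have tiSD: S :&: D = 1.
    apply/coprime_TIg/(pnat_coprime S2)/(pi_pnat qD).
    by rewrite !inE.
  have cxy: commute x y.
    apply/commgP; rewrite -in_set1 -[[set 1]]tiSD inE.
    rewrite {1}commgEl groupM ?groupV ?memJ_norm //=; last first.
      exact: subsetP (normal_norm nSH) _ (subsetP sDH _ Dy).
    by rewrite commgEr groupM // memJ_norm // groupV.
  case/eqP: q_neq2; rewrite -(prime_orders_pelt poG sDG qD Dy nty).
  rewrite -(even_order2 Sx ntx); apply/esym/(prime_orders_commute poG) => //.
    by rewrite !inE ntx (subsetP sSG).
  by rewrite !inE nty (subsetP sDG).
have := subset_leq_card (mul_subG sSH (subsetIl H 'N(D))).
by rewrite TI_cardMg // even_card_H even_card_S leq_pmul2l.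
Qed.

Lemma even_outer_sub_conj k : k \in G ->
  (D \subset H :^ k) = (k \in H * 'N_G(D)).
Proof.
move=> Gk; apply/idP/mulsgP=> [sDHk | [a n Ha /setIP[Gn nDn] ->]]; last first.
  by rewrite conjsgM (conjGid Ha) -(normP nDn) conjSg.
have sylDk: q.-Sylow(H) (D :^ k^-1)%G.
  rewrite pHallE /= sub_conjgV sDHk /= cardJg.
  by rewrite (card_Hall even_outer_sylH).
have [a Ha defD] := Sylow_trans even_outer_sylH sylDk.
exists a^-1 (a * k); rewrite ?groupV ?mulKg // inE groupM ?(subsetP sHG _ Ha) //=.
by apply/normP; rewrite conjsgM -[D :^ a]defD /= conjsgKV.
Qed.

Lemma even_outer_count :
  #|G| = (#|H| + q.+1 * (#|(H * 'N_G(D))%g| - #|H|))%N.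
Proof.
set X := H * 'N_G(D); have sHX: H \subset X by rewrite mulG_subl.
have sXG: X \subset G by rewrite mul_subG ?subsetIl.
have oSyl: #|'Syl_q(H)| = q.+1 by rewrite (card_Syl even_outer_sylH) even_outer_normH.
rewrite -(cardsID H G) (setIidPr sHG); congr (_ + _)%N.
rewrite -sum1_card (partition_big (fun g => (H :&: H :^ g)%G) (mem 'Syl_q(H))) /=; last first.
  move=> g /setDP[Gg notHg]; rewrite inE pHallE subsetIl even_capJ_card //=.
  by rewrite -(card_Hall even_outer_sylH) -oD.
rewrite -oSyl -sum_nat_const; apply: eq_bigr => P; rewrite inE => sylP.
have [h Hh defP] := Sylow_trans even_outer_sylH sylP.
have Gh := subsetP sHG h Hh.
rewrite sum1_card -(card_rcoset X h) -[in RHS](card_rcoset H h) (rcoset_id Hh).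
have sHXh: H \subset X :* h by rewrite -{1}(rcoset_id Hh) mulSg.
rewrite -(cardsDS sHXh).
rewrite -[LHS]cardsE; congr #|pred_of_set _|; apply/setP=> g.
rewrite in_set -[LHS]topredE /= !in_setD; have [Hg | notHg] := boolP (g \in H); first by [].
rewrite /= mem_rcoset; apply/andP/idP=> [[Gg /eqP defHg] | Xgh].
  rewrite -even_outer_sub_conj ?groupM ?groupV // conjsgM -sub_conjgV invgK.
  by rewrite -defP -defHg subsetIr.
have Gg: g \in G by rewrite -(mulgKV h g) groupM // (subsetP sXG).
split=> //; have:= Xgh; rewrite -even_outer_sub_conj ?groupM ?groupV //.
rewrite conjsgM -sub_conjgV invgK -defP => sPHg.
apply/eqP/val_inj/eqP; rewrite /= eq_sym eqEcard subsetI sPHg even_capJ_card //.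
by rewrite (pHall_sub sylP) /= (card_Hall sylP) -(card_Hall even_outer_sylH) oD leqnn.
Qed.

Lemma even_outer_orders : #|R| = q /\ #|G : H| = q.+2.
Proof.
have q0 := prime_gt0 q_pr.
have [_ oND] := even_outer_norm (subxx D) sDR nDu.
have [_ oNR] := even_outer_norm sDR (subxx R) nRu.
have /dvdnP[f oR]: q %| #|R| by rewrite -oD cardSg.
have H0: 0 < #|H| := cardG_gt0 _.
have oX: #|(H * 'N_G(D))%g| = (#|H| * (2 * f))%N.
  have := mul_cardG H 'N_G(D); rewrite oND setIA (setIidPl sHG) even_outer_normH oD oR.
  move/eqP; rewrite mulnAC !mulnA eqn_pmul2r // => /eqP <-.
  exact: mulnAC.
have f0: 0 < f by move: (cardG_gt0 R); rewrite oR; case: (f).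
have oN: #|G : H| = (1 + q.+1 * (2 * f - 1))%N.
  apply/eqP; rewrite -(eqn_pmul2l H0) (Lagrange sHG) even_outer_count oX.
  apply/eqP; rewrite mulnDr muln1; congr (_ + _)%N.
  by rewrite [RHS]mulnCA; congr (_ * _)%N; rewrite mulnBr muln1.
have /eqP/negPn := even_outer_Sylow_mod; rewrite negbK.
have sNG : 'N_G(R)%G \subset G := subsetIl _ _.
have := Lagrange sNG; rewrite oNR even_card_G oN.
set m := #|G : _| => oG /eqP m1.
have [k Dm]: exists k, m = (k * q).+1.
  by exists (m %/ q); rewrite {1}(divn_eq m q) m1 addn1.
have qf: ~~ (q %| f).
  apply/negP=> /dvdnP[g Df]; move: oG; rewrite oR Dm Df => oG.
  have g0: 0 < g by move: f0; rewrite Df; case: (g).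
  have: q %| 1 by apply: (sylow_count_dvd q0 g0 erefl erefl erefl oG).
  by rewrite dvdn1 => /eqP q1; move: (prime_gt1 q_pr); rewrite q1.
have f1: f = 1%N.
  have qf_nat: q.-nat f by apply: pnat_dvd qR; rewrite oR dvdn_mulr.
  by apply: (pnat_1 qf_nat); rewrite p'natE.
by rewrite oR f1 mul1n -[(2 * 1 - 1)%N]/1%N muln1 add1n.
Qed.

Lemma even_outer_card_G : #|G| = (q.+2 * (q.+1 * q))%N.
Proof. by rewrite even_card_G; case: even_outer_orders => _ ->. Qed.

Lemma even_outer_card_q : (2 * #|[set x in G | #[x] == q]|)%N = (q.-1 * (q.+1 * q.+2))%N.
Proof.
have [oR oN] := even_outer_orders.
have RD: R :=: D by apply/eqP; rewrite eq_sym eqEcard sDR oR oD leqnn.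
have sylD: q.-Sylow(G) D by rewrite -RD; apply: even_outer_Sylow.
have tiD := abelian_Sylow_TI poG sylD abD ntD.
have [_ oND] := even_outer_norm (subxx D) sDR nDu; rewrite oR in oND.
have ->: [set x in G | #[x] == q] = class_support D^# G.
  apply/setP=> x; rewrite inE; apply/andP/imset2P=> [[Gx /eqP ox] | [d g]].
    have qx: q.-group <[x]> by rewrite /pgroup -orderE ox pnat_id.
    have [|g Gg sxD] := Sylow_Jsub sylD _ qx; first by rewrite cycle_subG.
    have Dxg: x ^ g \in D by apply: subsetP sxD _ _; rewrite memJ_conjg cycle_id.
    exists (x ^ g) g^-1; rewrite ?groupV ?conjgK //.
    by apply/setD1P; rewrite conjg_eq1 -order_gt1 ox prime_gt1.
  case/setD1P=> ntd Dd Gg ->; rewrite groupJ // ?(subsetP sDG) // orderJ.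
  by rewrite (prime_orders_pelt poG sDG qD Dd ntd).
rewrite (card_support_normedTI tiD) [#|D^#|](_ : _ = q.-1); last first.
  by rewrite -oD (cardsD1 1 D) group1.
have:= Lagrange (subsetIl G 'N(D)); rewrite oND even_outer_card_G.
exact: order_count (prime_gt0 q_pr).
Qed.

End OuterInvolution.

Definition invol_pairs x :=
  [set p in setX I I | p.1 * p.2 == x].

Lemma invol_pairsP p x : p \in invol_pairs x ->
  [/\ p.1 \in G, #[p.1] = 2, p.2 = p.1 * x & x ^ p.1 = x^-1].
Proof.
case: p => u v; rewrite in_set in_setX /= => /andP[/andP[/setIdP[Gu /eqP ou]]].
case/setIdP=> Gv /eqP ov /eqP <-; split=> //.
  by rewrite mulgA order2_mul // mul1g.
exact: mul_involutions_conj.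
Qed.

Lemma invol_pairs_inj x (p r : gT * gT) :
  p \in invol_pairs x -> r \in invol_pairs x -> p.1 = r.1 -> p = r.
Proof.
case: p r => [a b] [c d] /invol_pairsP[/= _ _ -> _] /invol_pairsP[/= _ _ -> _].
by move=> ->.
Qed.

Lemma card_invol_pairs x : x \in G -> #|invol_pairs x| <= #|'C_G[x]|.
Proof.
move=> Gx; have [-> | /set0Pn[p0 Ip0]] := eqVneq (invol_pairs x) set0.
  by rewrite cards0.
have [G0 o0 _ x0] := invol_pairsP Ip0.
rewrite -(card_in_imset (f := fun p => p0.1 * p.1)).
  apply/subset_leq_card/subsetP=> _ /imsetP[p Ip ->].
  have [G1 o1 _ x1] := invol_pairsP Ip; rewrite inE groupM //=.
  by apply/cent1P; apply/commute_sym/commgP/conjg_fixP; rewrite conjgM x0 conjVg x1 invgK.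
move=> p r Ip Ir /= /mulgI; exact: invol_pairs_inj Ip Ir.
Qed.

Lemma card_invol_pairs1 : #|invol_pairs 1| <= #|I|.
Proof.
rewrite -(card_in_imset (f := fun p : gT * gT => p.1)); last first.
  by move=> p r; apply: invol_pairs_inj.
apply/subset_leq_card/subsetP=> _ /imsetP[p /invol_pairsP[G1 o1 _ _] ->].
by rewrite inE G1 o1.
Qed.

Lemma card_cent_invol x : x \in I -> #|'C_G[x]| = q.+1.
Proof.
move=> Ix; have [w Sw ntw] := trivgPn _ ntS.
have /imsetP[g Gg ->] := even_invol_conj (even_invol_S Sw ntw) Ix.
by rewrite -(conjGid Gg) cent1J -conjIg cardJg (even_cent1 Sw ntw) even_card_S.
Qed.

Lemma card_invol_pairs2 x : x \in I -> #|invol_pairs x| <= q.-1.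
Proof.
move=> Ix; have oC := card_cent_invol Ix; have [Gx /eqP ox] := setIdP Ix.
have ntx: x != 1 by rewrite -order_gt1 ox.
rewrite -(card_in_imset (f := fun p : gT * gT => p.1)); last first.
  by move=> p r; apply: invol_pairs_inj.
have -> : q.-1 = #|'C_G[x] :\ 1 :\ x|.
  have C1x: x \in 'C_G[x] :\ 1 by rewrite in_setD1 ntx in_setI Gx cent1id.
  have := cardsD1 1 'C_G[x]; have := cardsD1 x ('C_G[x] :\ 1).
  by rewrite oC C1x group1 !add1n => -> [->].
apply/subset_leq_card/subsetP=> _ /imsetP[[a b] Ip ->] /=.
have [/= G1 o1 Dp2 x1] := invol_pairsP Ip.
rewrite !in_setD1 in_setI G1 -order_gt1 o1 /=; apply/andP; split.
  apply: contraTneq Ip => p1x; rewrite in_set in_setX Dp2 p1x order2_mul //.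
  by rewrite [1 \in _]in_set order1 !andbF.
by apply/cent1P/commute_sym/commgP/conjg_fixP; rewrite x1 order2_inv.
Qed.

Lemma cent_invol_conj x : x \in I -> exists2 g, g \in G & 'C_G[x] = S :^ g.
Proof.
move=> Ix; have [w Sw ntw] := trivgPn _ ntS.
have /imsetP[g Gg ->] := even_invol_conj (even_invol_S Sw ntw) Ix; exists g => //.
by rewrite -{1}(conjGid Gg) cent1J -conjIg (even_cent1 Sw ntw).
Qed.

(* If (uv)^3 = (uw)^3 = 1 with v, w in the same Sylow 2-subgroup T, then both
   u^v and u^w lie in T^u, so v w^-1 normalises the Sylow 2-subgroup of u. *)
Lemma card_invol_order3 u :
  u \in I -> #|[set v in I | #[u * v] == 3]| <= #|G : H|.-1.
Proof.
move=> Iu; have [Gu /eqP ou] := setIdP Iu; set V := [set v in I | _].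
have VP v: v \in V -> [/\ v \in I, v \in G, #[v] = 2, #[u * v] = 3 & u ^ v = v ^ u].
  case/setIdP=> Iv /eqP ouv; have [Gv /eqP ov] := setIdP Iv; split=> //.
  have: (u * v) ^+ 3 = 1 by rewrite -ouv expg_order.
  rewrite !expgS mulg1 !mulgA => uv3; apply: (mulgI (u * v * u)).
  rewrite !conjgE !order2_inv // !mulgA uv3 -(mulgA _ u u) order2_mul // mulg1.
  by rewrite -(mulgA _ v v) order2_mul // mulg1 order2_mul.
have not_comm v: v \in V -> ~ commute u v.
  case/VP=> _ _ ov ouv _ cuv.
  have: (u * v) ^+ 2 = 1 by rewrite expgMn // -ou expg_order ou -ov expg_order mulg1.
  by move/eqP; rewrite -order_dvdn ouv.
have abC x : x \in I -> abelian 'C_G[x].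
  by case/cent_invol_conj=> g _ ->; rewrite abelianJ even_abelian.
rewrite -card_conjugates (cardsD1 'C_G[u]).
have -> : 'C_G[u] \in S :^: G.
  by have [g Gg ->] := cent_invol_conj Iu; apply: imset_f.
rewrite add1n /= -(card_in_imset (f := fun v => 'C_G[v])).
  apply/subset_leq_card/subsetP=> _ /imsetP[v Vv ->]; have [Iv Gv _ _ _] := VP v Vv.
  rewrite in_setD1; apply/andP; split; last first.
    by have [g Gg ->] := cent_invol_conj Iv; apply: imset_f.
  apply/eqP=> eC; have: u \in 'C_G[v] by rewrite eC in_setI Gu cent1id.
  by case/setIP=> _ /cent1P; apply: not_comm.
move=> v w Vv Vw eC; have [Iv Gv ov _ eu] := VP v Vv; have [Iw Gw ow _ ew] := VP w Vw.
apply/eqP; apply/idPn=> ne_vw; pose t := v * w^-1.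
have cvw: commute w v.
  have: w \in 'C_G[v] by rewrite eC in_setI Gw cent1id.
  by case/setIP=> _ /cent1P.
have ntt: t != 1 by rewrite -eq_mulgV1.
have It: t \in I.
  rewrite inE groupM ?groupV //=.
  have t2: t ^+ 2 = 1.
    rewrite expgMn; last by apply: commuteV; apply: commute_sym.
    by rewrite expgVn -{1}ov -{1}ow !expg_order invg1 mulg1.
  by rewrite (prime_orders_eq poG _ t2) // groupM ?groupV.
have CJ x y : y \in G -> 'C_G[x] :^ y = 'C_G[x ^ y].
  by move=> Gy; rewrite conjIg conjGid // cent1J.
have nUt: 'C_G[u] :^ t = 'C_G[u].
  rewrite conjsgM CJ // eu -CJ // eC CJ // -ew -CJ // -conjsgM mulgV conjsg1.
  by [].
have [g Gg defU] := cent_invol_conj Iu.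
have Ut: t \in 'C_G[u].
  rewrite defU mem_conjg; set y := t ^ g^-1.
  have: y \in H :&: I; last by rewrite even_HI => /setD1P[].
  have [Gt /eqP ot] := setIdP It; have Gy: y \in G by rewrite groupJ ?groupV.
  rewrite in_setI [y \in I]in_set Gy orderJ ot in_setI Gy !andbT /=.
  apply/normP; rewrite /y conjgE invgK conjsgM -defU (conjsgM _ t) nUt defU.
  exact: conjsgK.
have := not_comm v Vv; apply.
have Ctu: u \in 'C_G[t].
  have [Gt _] := setIP Ut; rewrite in_setI Gu; apply/cent1P/commute_sym.
  by case/setIP: Ut => _ /cent1P.
have Ctv: v \in 'C_G[t].
  rewrite in_setI Gv; apply/cent1P/commuteM; first exact: commute_refl.
  by apply/commuteV/commute_sym.
exact: (centsP (abC t It)).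
Qed.

Lemma sum_invol_pairs : \sum_(x in G) #|invol_pairs x| = (#|I| * #|I|)%N.
Proof.
rewrite -cardsX -sum1_card.
rewrite (partition_big (fun p : gT * gT => p.1 * p.2) (mem G)) /=; last first.
  case=> u v; rewrite in_setX => /andP[/setIdP[Gu _] /setIdP[Gv _]].
  exact: groupM.
by apply: eq_bigr => x _; rewrite sum1dep_card /invol_pairs.
Qed.

Lemma sum_invol_pairs3 (A : {set gT}) :
  {in A, forall x, #[x] = 3} -> \sum_(x in A) #|invol_pairs x| <= #|I| * #|G : H|.-1.
Proof.
move=> A3; apply: (@leq_trans (\sum_(u in I) #|[set v in I | #[u * v] == 3]|)).
  have ->: \sum_(x in A) #|invol_pairs x|
         = \sum_(p in setX I I | p.1 * p.2 \in A) 1.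
    rewrite (partition_big (fun p : gT * gT => p.1 * p.2) (mem A)) /=; last first.
      by move=> p /andP[].
    apply: eq_bigr => x Ax; rewrite -[LHS]sum1dep_card; apply: eq_bigl => p.
    by rewrite -andbA; congr (_ && _); case: eqP => [->|]; rewrite ?Ax ?andbF.
  rewrite [leqRHS](_ : _ = \sum_(p in setX I I | #[p.1 * p.2] == 3) 1).
    rewrite [leqRHS](bigID (fun p => p.1 * p.2 \in A)) /=.
    apply: leq_trans (leq_addr _ _); rewrite leq_eqVlt; apply/orP; left.
    apply/eqP/eq_bigl => p; rewrite -andbA; congr (_ && _).
    by apply/idP/andP=> [Ap | []] //; rewrite A3.
  transitivity (\sum_(u in I) \sum_(v in I | #[u * v] == 3) 1).
    by apply: eq_bigr => u _; rewrite sum1dep_card.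
  rewrite pair_big_dep /=; apply: eq_bigl => -[u v] /=.
  by rewrite in_setX -andbA.
rewrite -sum_nat_const; apply: leq_sum => u; exact: card_invol_order3.
Qed.

Lemma even_index3 : q = 3.
Proof.
have q_pr := even_index_prime; have q0 := prime_gt0 q_pr; have q1 := prime_gt1 q_pr.
apply/eqP; apply: contraTT q1 => q'3; rewrite -leqNgt.
have [u Iu notHu] := even_invol_outside.
have oG := even_outer_card_G Iu notHu.
have oQ := even_outer_card_q Iu notHu.
have [_ oN] := even_outer_orders Iu notHu.
have oI := even_card_I; rewrite oN in oI.
pose Q := [set x in G | #[x] == q].
pose O := [set x in G | [&& x != 1, x \notin I & x \notin Q]].
have O_order x : x \in O -> [/\ x \in G, x != 1, prime #[x], #[x] != 2 & #[x] != q].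
  case/setIdP=> Gx /and3P[ntx I'x Q'x]; split=> //.
  - by apply: poG; apply/setD1P.
  - by apply: contra I'x => ox; rewrite inE Gx.
  - by apply: contra Q'x => ox; rewrite inE Gx.
have oC x : x \in O -> #|'C_G[x]| %| q.+2.
  case/O_order=> Gx ntx px x2 xq.
  have: #|'C_G[x]| %| #|G| by rewrite cardSg ?subsetIl.
  have xC: #[x].-group 'C_G[x] by apply: prime_orders_cent1 => //; apply/setD1P.
  rewrite oG mulnCA Gauss_dvdr; last first.
    rewrite -even_card_S coprime_sym (pnat_coprime S2) // (pi_pnat xC) // !inE.
  rewrite mulnC Gauss_dvdr // coprime_sym.
  apply: (@pnat_coprime q); first by rewrite pnat_id.
  by apply: (pi_pnat xC); rewrite !inE.
have PO x : x \in O -> #|invol_pairs x| <= q.+2.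
  move=> Ox; have [Gx _ _ _ _] := O_order x Ox.
  by apply: leq_trans (card_invol_pairs Gx) _; rewrite dvdn_leq ?oC.
pose s := \sum_(x in O) #|invol_pairs x|.
have splitG (F : gT -> nat) : \sum_(x in G) F x
    = (F 1%g + (\sum_(x in I) F x + (\sum_(x in Q) F x + \sum_(x in O) F x)))%N.
  rewrite (bigD1 1) ?group1 //= (bigID (mem I)) /=; congr (_ + (_ + _))%N.
    apply: eq_bigl => x; apply/andP/idP=> [[] // | Ix]; split=> //.
    by have [-> /eqP ox] := setIdP Ix; rewrite -order_gt1 ox.
  rewrite (bigID (mem Q)) /=; congr (_ + _)%N; apply: eq_bigl => x.
    apply/andP/idP=> [[] // | Qx]; split=> //.
    have [Gx /eqP ox] := setIdP Qx; rewrite Gx -order_gt1 ox (prime_gt1 q_pr) inE Gx ox.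
    by apply: contraTneq even_q_odd => ->.
  by rewrite [in RHS]inE -!andbA.
have cG : (q.+2 * (q.+1 * q))%N = (#|I| + #|Q| + #|O|).+1.
  have := splitG (fun => 1%N); rewrite !sum1_card oG => ->.
  by rewrite add1n addnA.
have le_s : (q.+2 * #|O|)%N <= s.
  apply: pairs_count q0 oI oQ cG _.
  rewrite -sum_invol_pairs splitG leq_add ?card_invol_pairs1 //.
  rewrite leq_add //; first by rewrite -sum_nat_const leq_sum // => x; apply: card_invol_pairs2.
  rewrite leq_add2r -sum_nat_const leq_sum // => x /setIdP[Gx /eqP ox].
  apply: leq_trans (card_invol_pairs Gx) _; apply: dvdn_leq => //.
  have qC: q.-group 'C_G[x].
    by rewrite -ox prime_orders_cent1 //; apply/setD1P; rewrite -order_gt1 ox prime_gt1.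
  have: #|'C_G[x]| %| #|G| by rewrite cardSg ?subsetIl.
  have co_q n : ~~ (q %| n) -> coprime #|'C_G[x]| n.
    by rewrite -p'natE //; apply: pnat_coprime.
  have qS: ~~ (q %| q.+1) by rewrite -prime_coprime // coprimenS.
  have qSS: ~~ (q %| q.+2).
    rewrite -addn2 dvdn_addr // dvdn_prime2 //.
    by apply: contraTneq even_q_odd => ->.
  by rewrite oG Gauss_dvdr ?co_q // Gauss_dvdr ?co_q.
have [y Oy oy]: exists2 y, y \in O & #[y] = 3.
  have [|y Gy oy] := @Cauchy _ 3 G isT; first by rewrite oG dvd3_count.
  exists y => //; rewrite in_set Gy -order_gt1 oy !inE Gy oy /= eq_sym.
  exact: q'3.
have q2_3 : 3.-nat q.+2.
  have [Gy nty _ _ _] := O_order y Oy.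
  have oCy : #|'C_G[y]| = q.+2.
    apply/eqP; rewrite eqn_leq dvdn_leq ?oC //=.
    apply: leq_trans (card_invol_pairs Gy).
    have := le_s; rewrite /s (bigD1 y) //= (cardsD1 y O) Oy mulnDr muln1 => le_s'.
    rewrite -(leq_add2r (q.+2 * #|O :\ y|)) (leq_trans le_s') // leq_add2l.
    rewrite mulnC -sum_nat_const.
    rewrite [leqLHS](eq_bigl (fun x => x \in O :\ y)); last by move=> x; rewrite in_setD1 andbC.
    by apply: leq_sum => x; rewrite in_setD1 => /andP[_ Ox]; apply: PO.
  by rewrite -oCy -oy; apply: prime_orders_cent1 => //; apply/setD1P.
have O3 : {in O, forall x, #[x] = 3}.
  move=> x Ox; have [Gx ntx px _ _] := O_order x Ox.
  have: #[x] %| q.+2.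
    apply: dvdn_trans (oC x Ox); rewrite order_dvdG // inE Gx cent1id.
    by [].
  move=> dv_x; have := pnat_dvd dv_x q2_3; rewrite pnatE //.
  by rewrite inE => /eqP.
have := sum_invol_pairs3 O3; rewrite oN -/s => le_s3.
exact: pairs_count3 q0 oI oQ cG (leq_trans le_s le_s3).
Qed.

Theorem even_simple_order : #|G| = 60 /\ #|G : H| = 5.
Proof.
have [u Iu notHu] := even_invol_outside.
have oG := even_outer_card_G Iu notHu.
have [_ oN] := even_outer_orders Iu notHu.
by rewrite oG oN even_index3.
Qed.

End EvenSimple.

(** * Simple groups of odd order *)

Section SylowTI.

Variables (gT : finGroupType) (G : {group gT}).
Hypotheses (poG : prime_orders G) (simG : simple G).
Hypothesis smallG : smaller_classified #|G|.
Variable p : nat.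
Hypothesis notpG : ~~ p.-group G.
Implicit Types P R T : {group gT}.

Lemma Sylow_meet_eq P R :
  p.-Sylow(G) P -> p.-Sylow(G) R -> P :&: R != 1 -> P :=: R.
Proof.
have [n] := ubnP (#|P| - #|P :&: R|); elim: n P R => // n IHn P R.
rewrite ltnS => le_n sylP sylR ntD.
have [[sPG pP _] [sRG pR _]] := (and3P sylP, and3P sylR).
have oPR: #|P| = #|R| by rewrite (card_Hall sylP) (card_Hall sylR).
pose D := (P :&: R)%G.
have [sDP sDR]: D \subset P /\ D \subset R by rewrite subsetIl subsetIr.
have [DP | neDP] := eqVneq (gval D) P.
  by apply/eqP; rewrite eqEcard oPR leqnn andbT -DP.
have neDR: D :!=: R by apply: contraNneq neDP => DR; rewrite eqEcard sDP oPR -DR leqnn.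
have sDG := subset_trans sDP sPG.
have pD := pgroupS sDP pP.
have neDG: D :!=: G by apply: contraNneq notpG => <-.
have [K [nKN sylK sDK _]] := simple_norm_local poG simG smallG sDG ntD neDG pD.
have pK := pHall_pgroup sylK.
have sKG: K \subset G := subset_trans (normal_sub nKN) (subsetIl _ _).
have [T sylT sKT] := Sylow_superset sKG pK.
suffices meetT (Q : {group gT}) : p.-Sylow(G) Q -> D \proper Q -> #|Q| = #|P| -> Q :=: T.
  transitivity (gval T); first by apply: meetT; rewrite // properEneq neDP.
  by apply/esym; apply: meetT; rewrite // properEneq neDR.
move=> sylQ ltDQ oQ; have [sQG pQ _] := and3P sylQ.
have := nilpotent_proper_norm (pgroup_nil pQ) ltDQ => ltDN.
have sNK: 'N_Q(D) \subset K.
  rewrite (sub_normal_Hall sylK) ?setSI //.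
  exact: pgroupS (subsetIl _ _) pQ.
have sNQT: 'N_Q(D) \subset Q :&: T by rewrite subsetI subsetIl (subset_trans sNK).
have ltDT: #|D| < #|Q :&: T| := leq_trans (proper_card ltDN) (subset_leq_card sNQT).
apply: IHn => //.
  apply: leq_trans le_n; rewrite oQ; apply: ltn_sub2l => //.
  by rewrite (leq_trans ltDT) // -oQ subset_leq_card ?subsetIl.
by rewrite -cardG_gt1 (leq_ltn_trans (cardG_gt0 D) ltDT).
Qed.

Lemma Sylow_TI P : p.-Sylow(G) P -> P :!=: 1 -> normedTI P^# G 'N_G(P).
Proof.
move=> sylP ntP; apply/normedTI_memJ_P; split; rewrite ?subsetIl //.
  by rewrite setD_eq0 subG1.
move=> y g /setD1P[nty Py] Gg; rewrite in_setD1 in_setI conjg_eq1 nty Gg /=.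
apply/idP/idP=> [Pyg | nPg]; last by rewrite memJ_norm.
have sylPg: p.-Sylow(G) (P :^ g^-1)%G by rewrite pHallJ // groupV.
rewrite -groupV; apply/normP; apply/esym; apply: (Sylow_meet_eq sylP sylPg).
by apply/trivgPn; exists y; rewrite // inE Py mem_conjgV.
Qed.

Lemma Sylow_norm_semiregular P g x :
    p.-Sylow(G) P -> g \in 'N_G(P) -> g \notin P -> x \in P -> x != 1 ->
  ~ commute x g.
Proof.
move=> sylP Ng notPg Px ntx cxg; case/negP: notPg.
have [sPG pP _] := and3P sylP; have [Gg nPg] := setIP Ng.
have sylPN: p.-Sylow('N_G(P)) P by rewrite Sylow_subnorm.
rewrite (mem_normal_Hall sylPN) ?normalSG //.
apply: mem_p_elt (prime_orders_cent_pgroup poG sPG pP Px ntx) _.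
by rewrite inE Gg; apply/cent1P/commute_sym.
Qed.

Lemma Sylow_norm_Frobenius P :
    p.-Sylow(G) P -> P :!=: 1 -> 
  exists2 C : {group gT}, [Frobenius 'N_G(P) = P ><| C] & #|C| = #|'N_G(P) : P|.
Proof.
move=> sylP ntP; have [sPG pP _] := and3P sylP.
have sylPN: p.-Sylow('N_G(P)) P by rewrite Sylow_subnorm.
have nPN: P <| 'N_G(P)%G by rewrite normalSG.
have [C] := splitsP (SchurZassenhaus_split (pHall_Hall sylPN) nPN).
case/complP=> tiPC defN; have sCN: C \subset 'N_G(P) by rewrite -defN mulG_subr.
have oC: #|C| = #|'N_G(P) : P|.
  by rewrite -divgS ?normal_sub //= -defN TI_cardMg // mulKn.
have neP: 'N_G(P) != P.
  apply: simple_TI_norm (Sylow_TI sylP ntP) => //.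
  by apply: contraNneq notpG => <-.
exists C => //; apply/Frobenius_semiregularP => //.
- by rewrite sdprodE // (subset_trans sCN) ?normal_norm.
- apply: contraNneq neP => C1; rewrite -defN C1 mulg1.
  exact: eqxx.
move=> g /setD1P[ntg Cg]; apply/trivgP/subsetP=> x /setIP[Px /cent1P cxg].
rewrite inE; apply/idPn=> ntx.
have notPg: g \notin P.
  by apply: contra ntg => Pg; rewrite -in_set1 -[[set 1]]tiPC inE Pg.
exact: (Sylow_norm_semiregular sylP (subsetP sCN g Cg) notPg Px ntx cxg).
Qed.

End SylowTI.

Section OddOrder.

Import Order.TTheory GroupScope GRing.Theory Num.Theory.
Local Open Scope ring_scope.

Section Deviation.

Variables (R : realFieldType) (T : finType).
Implicit Types (A X Y : {set T}) (z : T -> int) (s : R) (b : int).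

(* Writing r = s - b, the hypothesis r <= 1/2 makes r ^+ 2 the least square
   distance of s to an integer, unless r < 0, when X alone suffices; finally
   m (e (1 - r) ^+ 2 + (m - e) r ^+ 2) - e (m - e) = (m r - e) ^+ 2. *)
Lemma sum_deviation_half A X z s b :
    X \subset A -> {in X, forall i, z i = b + 1} -> s - b%:~R <= 2^-1 ->
  (#|X| * (#|A| - #|X|))%:R <= #|A|%:R * \sum_(i in A) ((z i)%:~R - s) ^+ 2.
Proof.
move=> sXA zX le_s; set r := s - b%:~R in le_s.
have le_XA := subset_leq_card sXA.
rewrite (big_setID X) /= (setIidPr sXA).
have -> : \sum_(i in X) ((z i)%:~R - s) ^+ 2 = #|X|%:R * (1 - r) ^+ 2.
  rewrite mulr_natl -sumr_const; apply: eq_bigr => i Xi.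
  by rewrite zX // rmorphD /= /r; congr (_ ^+ 2); ring.
have e0 : 0 <= #|X|%:R :> R by rewrite ler0n.
have m0 : 0 <= #|A|%:R :> R by rewrite ler0n.
rewrite natrM natrB //; have le_em: #|X|%:R <= #|A|%:R :> R by rewrite ler_nat.
set S := \sum_(i in _) _; set e := #|X|%:R in e0 le_em *; set m := #|A|%:R in m0 le_em *.
have [r0 | r0] := ltP r 0.
  have S0: 0 <= S by apply: sumr_ge0 => i _; apply: sqr_ge0.
  have r1: 1 <= (1 - r) ^+ 2 by nra.
  have: e <= e * (1 - r) ^+ 2 + S by nra.
  nra.
have leS: (m - e) * r ^+ 2 <= S.
  rewrite /m /e -natrB // -(setIidPr sXA) -cardsD mulr_natl -sumr_const /S.
  apply: ler_sum => i _.
  have -> : (z i)%:~R - s = (z i - b)%:~R - r by rewrite rmorphB /= /r; ring.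
  set n := z i - b; have [n0 | n0] := leP n 0.
    have: n%:~R <= 0 :> R by rewrite lerz0.
    by nra.
  have n1: 1 <= n%:~R :> R by rewrite ler1z.
  by nra.
have -> : m * (e * (1 - r) ^+ 2 + S)
  = m * (S - (m - e) * r ^+ 2) + e * (m - e) + (m * r - e) ^+ 2 by ring.
have mS: 0 <= m * (S - (m - e) * r ^+ 2) by rewrite mulr_ge0 // subr_ge0.
by have := sqr_ge0 (m * r - e); lra.
Qed.

Lemma sum_deviation A X Y z s b :
    X \subset A -> Y \subset A -> #|X| = #|Y| ->
    {in X, forall i, z i = b + 1} -> {in Y, forall i, z i = b} ->
  (#|X| * (#|A| - #|X|))%:R <= #|A|%:R * \sum_(i in A) ((z i)%:~R - s) ^+ 2.
Proof.
move=> sXA sYA oXY zX zY; have [le_s | lt_s] := leP (s - b%:~R) 2^-1.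
  exact: sum_deviation_half sXA zX le_s.
rewrite oXY (eq_bigr (fun i => ((- z i)%:~R - - s) ^+ 2)) => [|i _]; last first.
  by rewrite rmorphN /= -opprD sqrrN.
apply: (@sum_deviation_half _ _ (fun i => - z i) _ (- (b + 1))) => //.
  by move=> i Yi; rewrite /= zY // opprD subrK.
rewrite rmorphN rmorphD /=; lra.
Qed.

End Deviation.

Section InvolutiveSum.

Lemma big_involution (R : nmodType) (T : finType) (f : T -> T) (A : {pred T}) (F : T -> R) :
    involutive f -> {in A, forall x, f x \in A} -> {in A, forall x, f x != x} ->
    {in A, forall x, F (f x) = F x} ->
  \sum_(x in A) F x
    = (\sum_(x in A | (enum_rank x < enum_rank (f x))%N) F x) *+ 2.
Proof.
move=> fK Af nfA Ff; rewrite (bigID (fun x => enum_rank x < enum_rank (f x))%N) /=.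
rewrite mulr2n; congr (_ + _); rewrite (reindex_inj (inv_inj fK)) /=.
apply: eq_big => [x | x /andP[Ax _]]; last by apply: Ff; have := Af _ Ax; rewrite fK.
rewrite fK -leqNgt; apply/andP/andP=> [[Afx] | [Ax]].
  have Ax: x \in A by have := Af _ Afx; rewrite fK.
  rewrite leq_eqVlt => /orP[/eqP/ord_inj/enum_rank_inj/eqP fx | -> //].
  by rewrite eq_sym (negPf (nfA x Ax)) in fx.
by move/ltnW=> ->; rewrite Af.
Qed.

End InvolutiveSum.

Section OddGroup.

Variables (gT : finGroupType) (G : {group gT}).
Hypothesis oddG : odd #|G|.

Lemma odd_order_neq_inv x : x \in G^#%g -> (x^-1 != x)%g.
Proof.
case/setD1P=> ntx Gx; apply: contra ntx => /eqP invx.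
have x2: (x ^+ 2 = 1)%g by rewrite expgS expg1 -{1}invx mulVg.
have: (#[x]%g %| 2)%N by rewrite order_dvdn x2.
have: odd #[x]%g by apply: dvdn_odd (order_dvdG Gx) oddG.
by rewrite -order_eq1; case: #[x]%g => [|[|[]]].
Qed.

(* Burnside: 0 = |G| '[chi, 1] is chi(1) plus twice an algebraic integer when
   chi is real, so chi(1) would be an even divisor of |G|. *)
Lemma odd_conjC_irr i : ('chi[G]_i)^*%CF = 'chi_i -> i = 0.
Proof.
move=> chi_real; apply/eqP; apply: contraT => nz_i.
have: '['chi_i, 'chi_0] == 0 by rewrite cfdot_irr (negPf nz_i).
rewrite cfdotE mulf_eq0 invr_eq0 (negPf (neq0CG G)) /= (big_setD1 1%g) //=.
rewrite irr0 cfun1E group1 conjC1 mulr1.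
rewrite (eq_bigr (fun x => 'chi_i x)); last first.
  by move=> x /setD1P[_ Gx]; rewrite cfun1E Gx conjC1 mulr1.
rewrite (@big_involution _ _ (fun x => x^-1%g)); first last.
- by move=> x _; rewrite irr_inv -[in RHS]chi_real cfunE.
- exact: odd_order_neq_inv.
- by move=> x; rewrite !inE eq_invg1 groupV.
- exact: invgK.
set t := \sum_(x in _ | _) _; have At: t \in Aint.
  by rewrite rpred_sum // => x _; apply: Aint_irr.
rewrite addr_eq0 => /eqP Dchi1.
have [d Dd] := natrP (Cnat_irr1 i).
have d_dv : (d %| #|G|)%N by have := dvd_irr1_cardG i; rewrite Dd dvdC_nat.
have : odd d by apply: dvdn_odd d_dv oddG.
suffices: (2 %| d)%N by rewrite dvdn2 => /negPf->.
have Dt: t = - (d%:R / 2%:R).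
  by rewrite -Dd Dchi1 -(mulr_natr t 2) mulNr opprK mulfK ?pnatr_eq0.
have /intrP[z Dz]: t \in Num.int.
  by rewrite Cint_rat_Aint // Dt rpredN rpred_div ?rpred_nat.
have: (d%:Z)%:~R = (- z * 2%:Z)%:~R :> algC.
  by rewrite -[LHS]Dd Dchi1 Dz intrM rmorphN /= mulNr -(mulr_natr (z%:~R) 2).
move/intr_inj/(congr1 absz); rewrite abszM => /= ->.
exact: dvdn_mull.
Qed.

Lemma odd_conjC_Iirr i : i != 0 -> conjC_Iirr i != i :> Iirr G.
Proof.
apply: contra => /eqP ci; apply/eqP/odd_conjC_irr.
by rewrite -conjC_IirrE ci.
Qed.

Lemma cfdot_real_vchar_parity (phi psi : 'CF(G)) :
    phi \in 'Z[irr G] -> psi \in 'Z[irr G] ->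
    (phi^*)%CF = phi -> (psi^*)%CF = psi ->
  exists2 z, z \in Num.int & '[phi, psi] = '[phi, 1] * '[psi, 1] + z *+ 2.
Proof.
move=> Zphi Zpsi Rphi Rpsi; rewrite cfdot_vchar_r // (bigD1 0) //= irr0.
have dot_conj (f : 'CF(G)) i : f \in 'Z[irr G] -> (f^*)%CF = f ->
    '[f, 'chi_(conjC_Iirr i)] = '[f, 'chi_i].
  move=> Zf Rf; rewrite -{1}Rf conjC_IirrE cfdot_conjC aut_intr //.
  exact: Cint_cfdot_vchar_irr.
exists (\sum_(i in predC1 (0 : Iirr G) | (enum_rank i < enum_rank (conjC_Iirr i))%N)
   '[phi, 'chi_i] * '[psi, 'chi_i]).
  by rewrite rpred_sum // => i _; rewrite rpredM ?Cint_cfdot_vchar_irr.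
congr (_ + _); apply: (big_involution (A := predC1 (0 : Iirr G))).
- exact: conjC_IirrK.
- by move=> i; rewrite !inE conjC_Iirr_eq0.
- by move=> i; apply: odd_conjC_Iirr.
- by move=> i _; rewrite !dot_conj.
Qed.

End OddGroup.

Section TI.

Variables (gT : finGroupType) (G L : {group gT}) (A : {set gT}).
Hypotheses (tiA : normedTI A G L) (sAL : A \subset L).

Lemma cfInd_TI (phi : 'CF(L)) : phi \in 'CF(L, A) -> {in A, 'Ind[G] phi =1 phi}.
Proof.
have [_ sLG tiAG] := normedTI_memJ_P tiA.
move=> Aphi x Ax /=; rewrite cfIndE // (big_setID L) /= addrC.
apply: canLR (mulKf (neq0CG L)) _; rewrite (setIidPr sLG) mulr_natl.
rewrite big1 ?add0r => [|y /setDP[Gy L'y]]; last first.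
  by rewrite (cfun_on0 Aphi) // tiAG.
by rewrite -sumr_const; apply: eq_bigr => y Ly; rewrite cfunJ.
Qed.

Lemma cfdot_Ind_TI (phi psi : 'CF(L)) :
  phi \in 'CF(L, A) -> psi \in 'CF(L, A) -> '['Ind[G] phi, 'Ind[G] psi] = '[phi, psi].
Proof.
have [_ sLG tiAG] := normedTI_memJ_P tiA.
move=> Aphi Apsi; rewrite -cfdot_Res_l !(cfdotEr _ Apsi); congr (_ * _).
apply: eq_bigr => x Ax; congr (_ * _).
by rewrite cfResE ?(subsetP sAL) // cfInd_TI.
Qed.

Lemma sum_class_support_TI (F : gT -> algC) :
    {in A & G, forall x y, F (x ^ y)%g = F x} ->
  \sum_(x in class_support A G) F x = #|G : L|%:R * \sum_(x in A) F x.
Proof.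
move=> FJ; have partAG := partition_normedTI tiA.
have [_ tiAG /eqP defL] := and3P tiA.
rewrite -(cover_partition partAG) big_trivIset //=.
rewrite (eq_bigr (fun=> \sum_(x in A) F x)) => [|_ /imsetP[g Gg ->]]; last first.
  rewrite big_imset /=; last by move=> x y _ _; apply: conjg_inj.
  by apply: eq_bigr => x Ax; rewrite FJ.
by rewrite sumr_const card_conjugates defL mulr_natl.
Qed.

End TI.

Section GaloisValues.

Variables (gT : finGroupType) (G : {group gT}).
Implicit Types (chi : 'CF(G)) (c : Iirr G) (x : gT).

Lemma char_cycle_aut (u : {rmorphism algC -> algC}) k chi x :
    chi \is a character -> x \in G ->
    (forall z, z ^+ #[x]%g = 1 -> u z = z ^+ k) ->
  u (chi x) = chi (x ^+ k)%g.
Proof.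
move=> Nchi Gx uk; have sxG: <[x]>%g \subset G by rewrite cycle_subG.
rewrite -(cfResE chi sxG (cycle_id x)) -(cfResE chi sxG (mem_cycle x k)).
have [r ->] := char_sum_irr (cfRes_char <[x]> Nchi).
rewrite !sum_cfunE rmorph_sum; apply: eq_bigr => i _.
have Lxi: 'chi_i \is a linear_char by apply/irr_cyclic_lin/cycle_cyclic.
rewrite uk ?lin_charX ?cycle_id // -lin_charX ?cycle_id // expg_order.
exact: lin_char1.
Qed.

Lemma char_prime_rational chi x p :
    chi \is a character -> x \in G -> prime p -> #[x]%g = p ->
    (forall i, (0 < i < p)%N -> chi (x ^+ i)%g = chi x) ->
  chi x \in Num.int /\ exists2 z, z \in Num.int & chi 1%g = chi x + p%:R * z.
Proof.
move=> Nchi Gx p_pr ox eq_chi.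
have sxG: <[x]>%g \subset G by rewrite cycle_subG.
have [n Dn]: exists n : nat, '['Res[<[x]>] chi, 'chi_0] = n%:R.
  by apply/natrP/Cnat_cfdot_char_irr/cfRes_char.
have sum_chi: chi 1%g + chi x *+ p.-1 = n%:R * p%:R.
  rewrite -Dn irr0 cfdotE -orderE ox mulrC mulVKf ?pnatr_eq0 -?lt0n ?prime_gt0 //.
  rewrite (eq_bigr (fun y => chi y)) => [|y xy]; last first.
    by rewrite cfResE // cfun1E xy conjC1 mulr1.
  have defX: <[x]>%g = [set (x ^+ i)%g | i : 'I_p].
    apply/setP=> z; apply/idP/imsetP=> [/cyclePmin[i ltip ->] | [i _ ->]].
      by rewrite ox in ltip; exists (Ordinal ltip).
    exact: mem_cycle.
  rewrite [RHS](eq_bigl (mem [set (x ^+ i)%g | i : 'I_p])) /=; last first.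
    by move=> y; rewrite -defX.
  rewrite big_imset /=; last first.
    move=> i j _ _ /eqP.
    by rewrite eq_expg_mod_order ox !modn_small // => /eqP/val_inj.
  case: p p_pr ox eq_chi {defX} => // p p_pr ox eq_chi; rewrite big_ord_recl expg0.
  congr (_ + _); rewrite (eq_bigr (fun=> chi x)) => [|i _].
    by rewrite sumr_const card_ord.
  by rewrite eq_chi //= ltnS.
have [d Dd] := natrP (Cnat_char1 Nchi).
have p1: (p.-1)%:R != 0 :> algC by rewrite pnatr_eq0 -lt0n -ltnS prednK ?prime_gt0 ?prime_gt1.
have Zchi: chi x \in Num.int.
  rewrite Cint_rat_Aint ?Aint_char //.
  have ->: chi x = (n%:R * p%:R - d%:R) / (p.-1)%:R.
    by rewrite -sum_chi Dd addrC addKr -(mulr_natr (chi x)) mulfK.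
  by rewrite rpred_div ?rpredB ?rpredM ?rpred_nat.
split=> //; exists (n%:R - chi x); first by rewrite rpredB ?rpred_nat.
apply: (addIr (chi x *+ p.-1)); rewrite sum_chi addrAC -mulrS prednK ?prime_gt0 //.
by rewrite mulrBr -(mulr_natl (chi x) p) mulrC [RHS]addrC subrK.
Qed.

Lemma irr_aut_rational c k x :
    conjC_Iirr c != c -> prime k -> prime #[x]%g -> k != #[x]%g -> x \in G ->
    (forall u : {rmorphism algC -> algC}, (forall z, z ^+ k = 1 -> u z = z) ->
       cfAut u ('chi_c - ('chi_c)^*%CF) = 'chi_c - ('chi_c)^*%CF) ->
  forall i, (0 < i < #[x]%g)%N -> 'chi[G]_c (x ^+ i)%g = 'chi_c x.
Proof.
move=> ncc k_pr p_pr k'p Gx Qk i /andP[i_gt0 i_lt]; set p := #[x]%g in p_pr k'p i_lt.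
have co_kp: coprime k p by rewrite prime_coprime // dvdn_prime2.
pose a := chinese k p 1 i.
have a1: a = 1 %[mod k] := chinese_modl co_kp 1 i.
have ai: a = i %[mod p] := chinese_modr co_kp 1 i.
have co_a: coprime a (k * p).
  rewrite coprimeMr -coprime_modl a1 coprime_modl coprime1n /=.
  by rewrite -coprime_modl ai coprime_modl coprime_sym prime_coprime // gtnNdvd.
have [u Du] := Qn_aut_exists co_a.
have uk z: z ^+ k = 1 -> u z = z.
  move=> zk; rewrite Du ?exprM ?zk ?expr1n //.
  by rewrite (divn_eq a k) a1 modn_small ?prime_gt1 // exprD mulnC exprM zk expr1n mul1r.
have fix_c: aut_Iirr u c = c.
  apply/eqP; have := congr1 (cfdotr 'chi_c) (Qk u uk); rewrite /cfdotr.
  rewrite rmorphB /= -conjC_IirrE -!aut_IirrE !cfdotBl !cfdot_irr eqxx (negPf ncc).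
  rewrite subr0; case: (aut_Iirr u c == c) => //.
  case: (_ == _) => /eqP; rewrite sub0r ?oppr0 eq_sym ?oner_eq0 //.
  by rewrite -subr_eq0 opprK paddr_eq0 ?oner_eq0.
have -> : (x ^+ i = x ^+ a)%g by apply/eqP; rewrite eq_expg_mod_order -/p ai.
rewrite -(@char_cycle_aut u a _ x (irr_char c) Gx); last first.
  by move=> z zp; rewrite Du // mulnC exprM -/p zp expr1n.
by rewrite -[in RHS]fix_c aut_IirrE cfunE.
Qed.

End GaloisValues.

Definition order_class (gT : finGroupType) (G : {set gT}) (p : nat) :=
  [set x in G | #[x]%g == p].

(* For a Sylow p-subgroup P with normaliser L and a linear character lambda != 1
   of P: e = |L : P|, m = |P : P'|, alpha = 'Ind[G] ('Ind[L, P] 1 - zeta) where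
   zeta = 'Ind[L] lambda, and 'Ind[G] (zeta - zeta^* ) = 'chi_c - ('chi_c)^*. *)
Record exceptional (gT : finGroupType) (G : {group gT}) (p e m : nat)
    (alpha : 'CF(G)) (c : Iirr G) : Prop := Exceptional {
  exc_vchar : alpha \in 'Z[irr G];
  exc_on : alpha \in 'CF(G, order_class G p);
  exc_norm : '[alpha] = e.+1%:R;
  exc_dot1 : '[alpha, 1] = 1;
  exc_dot : '[alpha, 'chi_c - ('chi_c)^*%CF] = -1;
  exc_real : alpha - (alpha^*)%CF = ('chi_c)^*%CF - 'chi_c;
  exc_diff_on : 'chi_c - ('chi_c)^*%CF \in 'CF(G, order_class G p);
  exc_neq : conjC_Iirr c != c;
  exc_aut : forall u : {rmorphism algC -> algC}, (forall z, z ^+ p = 1 -> u z = z) ->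
    cfAut u ('chi_c - ('chi_c)^*%CF) = 'chi_c - ('chi_c)^*%CF;
  exc_own : (#|G| * (m - e))%:R
      <= m%:R * \sum_(x in order_class G p) `|'chi_c x| ^+ 2;
  exc_bound : forall x, `|alpha x| <= (2 * e)%:R;
  exc_card : (e * #|order_class G p| < #|G|)%N;
  exc_index : (2 < e)%N /\ odd e;
  exc_lin : p.-nat m /\ (m = (2 * e).+1 \/ ((4 * e).+1 <= m)%N)
}.

Section Exceptional.

Variables (gT : finGroupType) (G : {group gT}).
Hypotheses (poG : prime_orders G) (simG : simple G).
Hypothesis smallG : smaller_classified #|G|.
Hypothesis oddG : odd #|G|.
Variables (p : nat) (P : {group gT}).
Hypotheses (notpG : ~~ p.-group G) (sylP : p.-Sylow(G)%g P).
Hypothesis ntP : P :!=: 1%g.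

Local Notation L := 'N_G(P)%G.
Local Notation e := #|L : P|%g.
Local Notation h := #|P|.
Local Notation m := #|P : P^`(1)|%g.

Let sPG : P \subset G := pHall_sub sylP.
Let pP : p.-group P := pHall_pgroup sylP.
Let nPL : P <| L. Proof. by rewrite normalSG. Qed.
Let sPL : P \subset L := normal_sub nPL.
Let sLG : L \subset G := subsetIl _ _.
Let tiP : normedTI P^#%g G L := Sylow_TI poG simG smallG notpG sylP ntP.
Let oddL : odd #|L| := oddSg sLG oddG.
Let oddP : odd #|P| := oddSg sPG oddG.
Let p_pr : prime p. Proof. by have [] := pgroup_pdiv pP ntP. Qed.
Let sAL : P^#%g \subset L. Proof. exact: subset_trans (subsetDl _ _) sPL. Qed.

Variable C : {group gT}.
Hypotheses (frobL : [Frobenius L = P ><| C]) (oC : #|C| = e).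
Let frobLk : [Frobenius L with kernel P] := FrobeniusWker frobL.

Lemma exc_index_proof : (2 < e)%N /\ odd e.
Proof.
have odd_e: odd e := dvdn_odd (dvdn_indexg L P) oddL.
have [_ _ ntC _ _] := Frobenius_context frobL.
rewrite -cardG_gt1 oC in ntC; split=> //.
by move: ntC odd_e; case: e => [|[|[|]]].
Qed.

Lemma exc_lin_proof : p.-nat m /\ (m = (2 * e).+1 \/ ((4 * e).+1 <= m)%N).
Proof.
split; first exact: pnat_dvd (dvdn_indexg _ _) pP.
have [defL _ ntC _ _] := Frobenius_context frobL.
have nsP'L: P^`(1)%g <| L := char_normal_trans (der_char 1 P) nPL.
have ltP'P: P^`(1)%g \proper P.
  by rewrite (sol_der1_proper (pgroup_sol pP)) ?subxx.
have frobLb: [Frobenius L / P^`(1) = (P / P^`(1)) ><| (C / P^`(1))]%g.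
  apply: Frobenius_coprime_quotient => //; first by split=> //; apply: Frobenius_coprime frobL.
  split=> // x Cx; rewrite (Frobenius_reg_ker frobL Cx); exact: sub1G.
have [_ sCL _ _ tiPC] := sdprod_context defL.
have oCb: #|(C / P^`(1))%g| = e.
  rewrite -oC; apply/esym/card_isog/quotient_isog.
    exact: subset_trans sCL (normal_norm nsP'L).
  by apply/trivgP; rewrite -tiPC setSI // der_sub.
have := Frobenius_dvd_ker1 frobLb; rewrite /= oCb (card_quotient (der_norm 1 P)).
case/dvdnP=> l Dl; have m0 : (0 < m)%N := indexg_gt0 _ _.
have Dm: m = (l * e).+1 by rewrite -Dl prednK.
have odd_m: odd m := dvdn_odd (dvdn_indexg _ _) oddP.
have m1: (1 < m)%N by rewrite indexg_gt1 proper_subn.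
have [e2 odd_e] := exc_index_proof.
move: odd_m m1; rewrite Dm /= oddM odd_e andbT ltnS.
case: l Dl Dm => [|[|[|[|l]]]] //; first by left.
by right; rewrite ltnS leq_mul2r orbT.
Qed.

Lemma order_classE : order_class G p = class_support P^#%g G.
Proof.
apply/setP=> x; rewrite inE; apply/andP/imset2P=> [[Gx /eqP ox] | [d g]].
  have px: p.-group <[x]>%g by rewrite /pgroup -orderE ox pnat_id.
  have [|g Gg sxP] := Sylow_Jsub sylP _ px; first by rewrite cycle_subG.
  have Pxg: (x ^ g)%g \in P by apply: subsetP sxP _ _; rewrite memJ_conjg cycle_id.
  exists (x ^ g)%g g^-1%g; rewrite ?groupV ?conjgK //.
  by rewrite !inE Pxg conjg_eq1 -order_gt1 ox prime_gt1.
case/setD1P=> ntd Pd Gg ->; rewrite groupJ // ?(subsetP sPG) // orderJ.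
by rewrite (prime_orders_pelt poG sPG pP Pd ntd).
Qed.

Lemma exc_card_proof : (e * #|order_class G p| < #|G|)%N.
Proof.
rewrite order_classE (card_support_normedTI tiP) -(Lagrange sLG) mulnA.
rewrite -(Lagrange sPL) ltn_pmul2r // mulnC (cardsD1 1%g P) group1 mulSn.
by rewrite -[X in (X < _)%N]add0n ltn_add2r.
Qed.

Variable i0 : Iirr P.
Hypotheses (nz_i0 : i0 != 0) (lin_i0 : 'chi_i0 \is a linear_char).

Local Notation zeta := ('Ind[L] 'chi_i0).
Local Notation beta := (zeta - (zeta^*)%CF).
Local Notation alpha0 := ('Ind[L, P] 1 - zeta).
Local Notation alpha := ('Ind[G] alpha0).

Let irr_zeta : zeta \in irr L := irr_induced_Frobenius_ker frobLk nz_i0.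

Let zeta1 : zeta 1%g = e%:R.
Proof. by rewrite cfInd1 // lin_char1 // mulr1. Qed.

Let dot_Ind1 (i : Iirr P) : '['Ind[L, P] 1, 'Ind[L] 'chi_i] = e%:R * (i == 0)%:R.
Proof.
rewrite -cfdot_Res_l cfInd_cfun1 // linearZ /= cfdotZl.
have -> : 'Res[P, L] '1_P = 1.
  by apply/cfun_inP => x Px; rewrite cfResE // cfuniE // cfun1E Px.
by rewrite -irr0 cfdot_irr eq_sym.
Qed.

Let conj_zeta : (zeta^*)%CF = 'Ind[L] 'chi_(conjC_Iirr i0).
Proof. by rewrite cfAutInd conjC_IirrE. Qed.

Let zeta_conj_neq : '[zeta, (zeta^*)%CF] = 0.
Proof.
have /irrP[k Dk] := irr_zeta; rewrite Dk -conjC_IirrE cfdot_irr.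
rewrite eq_sym (negPf (odd_conjC_Iirr oddL _)) //.
apply/eqP=> k0; have := zeta1; rewrite Dk k0 irr0 cfun11 => /esym/eqP.
have [e2 _] := exc_index_proof; rewrite (eqr_nat _ _ 1) => /eqP e1.
by rewrite e1 in e2.
Qed.

Let norm_zeta : '[zeta] = 1.
Proof. by have /irrP[k ->] := irr_zeta; rewrite cfnorm_irr. Qed.

Let beta_on : beta \in 'CF(L, P^#%g).
Proof.
rewrite cfun_onD1 rpredB ?cfInd_normal //=; last by rewrite cfAut_on cfInd_normal.
by rewrite !cfunE zeta1 rmorph_nat subrr.
Qed.

Let alpha0_on : alpha0 \in 'CF(L, P^#%g).
Proof.
rewrite cfun_onD1 rpredB ?cfInd_normal //=.
by rewrite !cfunE zeta1 cfInd1 // cfun11 mulr1 subrr.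
Qed.

Let Zbeta : beta \in 'Z[irr L].
Proof.
by rewrite rpredB ?cfConjC_vchar //; have /irrP[k ->] := irr_zeta; apply: irr_vchar.
Qed.

Let norm_beta : '[beta] = 2%:R.
Proof. by rewrite cfnormBd // norm_zeta cfnorm_conjC norm_zeta. Qed.

Let Ind_class_on (phi : 'CF(L)) :
  phi \in 'CF(L, P^#%g) -> 'Ind[G] phi \in 'CF(G, order_class G p).
Proof. by move=> Pphi; rewrite order_classE cfInd_on. Qed.

Lemma exc_char_exists : exists2 c : Iirr G,
  'Ind[G] beta = 'chi_c - ('chi_c)^*%CF & conjC_Iirr c != c.
Proof.
have ZIb: 'Ind[G] beta \in 'Z[irr G, G^#%g].
  rewrite zcharD1E cfInd_vchar //= cfInd1 // (cfun_on0 beta_on) ?mulr0 //.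
  by rewrite !inE eqxx.
have [|c [d ne_dc Db]] := vchar_norm2 ZIb.
  by rewrite (cfdot_Ind_TI tiP sAL) // norm_beta.
have Dd: d = conjC_Iirr c.
  have : '[('Ind[G] beta)^*%CF, 'chi_(conjC_Iirr c)] = 1.
    rewrite conjC_IirrE cfdot_conjC Db cfdotBl !cfdot_irr eqxx (negPf ne_dc).
    by rewrite subr0 conjC1.
  have -> : ('Ind[G] beta)^*%CF = - 'Ind[G] beta.
    transitivity ('Ind[G] (- beta)); last by rewrite linearN.
    rewrite cfAutInd; congr ('Ind[G] _).
    apply/cfunP=> x; rewrite !cfunE rmorphB opprB.
    by congr (_ - _); apply: conjCK.
  rewrite Db opprB cfdotBl !cfdot_irr; case: eqP => [-> //|_].
  case: eqP => _ /eqP; rewrite sub0r ?oppr0 eq_sym ?oner_eq0 //.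
  by rewrite -subr_eq0 opprK paddr_eq0 ?oner_eq0.
by exists c; rewrite -?conjC_IirrE -Dd.
Qed.

Variable c : Iirr G.
Hypothesis Dchi : 'Ind[G] beta = 'chi_c - ('chi_c)^*%CF.
Hypothesis ncc : conjC_Iirr c != c.

Let dot_alpha0_beta : '[alpha0, beta] = -1.
Proof.
rewrite cfdotBl !cfdotBr norm_zeta zeta_conj_neq conj_zeta !dot_Ind1.
by rewrite conjC_Iirr_eq0 (negPf nz_i0) mulr0 !subr0 sub0r.
Qed.

Lemma exc_aut_proof (u : {rmorphism algC -> algC}) :
  (forall z, z ^+ p = 1 -> u z = z) ->
  cfAut u ('chi_c - ('chi_c)^*%CF) = 'chi_c - ('chi_c)^*%CF.
Proof.
move=> up.
have fix_lin (j : Iirr P) : 'chi_j \is a linear_char -> cfAut u 'chi_j = 'chi_j.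
  move=> lin_j; apply/cfun_inP=> x Px; rewrite cfunE; apply: up.
  rewrite -lin_charX //; have [->|ntx] := eqVneq x 1%g.
    by rewrite expg1n lin_char1.
  by rewrite -(prime_orders_pelt poG sPG pP Px ntx) expg_order lin_char1.
have lin_ci : 'chi_(conjC_Iirr i0) \is a linear_char.
  by rewrite conjC_IirrE cfAut_lin_char.
have -> : 'chi_c - ('chi_c)^*%CF = 'Ind[G] ('Ind[L] ('chi_i0 - 'chi_(conjC_Iirr i0))).
  by rewrite -Dchi conj_zeta [in RHS]linearB.
rewrite !cfAutInd; congr ('Ind[G] ('Ind[L] _)).
rewrite -{2}(fix_lin _ lin_i0) -{2}(fix_lin _ lin_ci).
by apply/cfunP=> x; rewrite !cfunE rmorphB.
Qed.

Lemma exc_bound_proof x : `|'Ind[G] alpha0 x| <= (2 * e)%:R.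
Proof.
have [Cx | notCx] := boolP (x \in order_class G p); last first.
  by rewrite (cfun_on0 (Ind_class_on alpha0_on)) // normr0 ler0n.
move: Cx; rewrite order_classE => /imset2P[y g Py Gg ->]; rewrite cfunJ //.
rewrite (cfInd_TI tiP alpha0_on) // 2!cfunE (le_trans (ler_normB _ _)) //.
have Nz: zeta \is a character by have /irrP[k ->] := irr_zeta; apply: irr_char.
have N1: 'Ind[L, P] 1 \is a character by rewrite cfInd_char ?rpred1.
rewrite mul2n -addnn natrD lerD //.
  by rewrite (le_trans (char1_ge_norm y N1)) // cfInd1 // cfun11 mulr1.
by rewrite (le_trans (char1_ge_norm y Nz)) // zeta1.
Qed.

Let psi := 'Res[P] 'chi_c.

(* Removing a multiple of the regular character makes the restriction of chi
   vanish at 1 without changing it on P^#; Bessel's inequality for the linear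
   characters then bounds the norm below. *)
Lemma exc_Res_norm :
  (e * (m - e))%:R <= m%:R * (h%:R^-1 * \sum_(x in P^#%g) `|'chi_c x| ^+ 2).
Proof.
have Npsi : psi \is a character by rewrite cfRes_char ?irr_char.
have /fin_all_exists[z Dz] (i : Iirr P) : exists n : int, '[psi, 'chi_i] = n%:~R.
  by have /natrP[n ->] := Cnat_cfdot_char_irr i Npsi; exists n%:Z.
have [d Dd] := natrP (Cnat_char1 Npsi).
pose s : rat := d%:R / h%:R; pose f := psi - ratr s *: cfReg P.
have h0 : h%:R != 0 :> algC := neq0CG P.
have fE x : f x = psi x - ratr s * cfReg P x by rewrite !cfunE.
have f1 : f 1%g = 0.
  rewrite fE Dd cfRegE eqxx mulr1n /s fmorph_div !rmorph_nat /=.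
  by rewrite divfK // subrr.
have fchi : {in P^#%g, f =1 'chi_c}.
  move=> x /setD1P[ntx Px]; rewrite fE cfRegE (negPf ntx) mulr0 subr0.
  by rewrite cfResE.
have -> : h%:R^-1 * \sum_(x in P^#%g) `|'chi_c x| ^+ 2 = '[f].
  rewrite (cfnormE (cfun_onG f)); congr (_ * _).
  rewrite [RHS](big_setD1 1%g) //= f1 normr0 expr0n add0r.
  by apply: eq_bigr => x Ax; rewrite fchi.
pose A := [set i : Iirr P | 'chi_i \is a linear_char].
have oA : #|A| = m by rewrite cardsE card_lin_irr.
have dot_reg (i : Iirr P) : '[cfReg P, 'chi_i] = 'chi_i 1%g.
  rewrite cfReg_sum cfdot_suml (bigD1 i) //= big1 ?addr0 => [|j ne_ji].
    by rewrite cfdotZl cfnorm_irr mulr1.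
  by rewrite cfdotZl cfdot_irr (negPf ne_ji) mulr0.
have le_f : \sum_(i in A) `|'[f, 'chi_i]| ^+ 2 <= '[f].
  rewrite cfdot_sum_irr [leRHS](bigID (mem A)) /= ler_wpDr //.
    by apply: sumr_ge0 => i _; rewrite -normCK exprn_ge0.
  by apply: ler_sum => i _; rewrite -normCK.
apply: le_trans (ler_wpM2l (ler0n _ _) le_f).
have Df i : i \in A -> `|'[f, 'chi_i]| ^+ 2 = ratr (((z i)%:~R - s) ^+ 2).
  rewrite inE => lin_i; rewrite cfdotBl cfdotZl dot_reg lin_char1 // mulr1 Dz.
  rewrite rmorphXn rmorphB /= ratr_int -[_ - ratr s]/(_ - _) real_normK //.
  by rewrite rpredB ?realz // rpred_div ?realz.
rewrite (eq_bigr _ Df) -rmorph_sum -[m%:R]ratr_nat -[_%:R]ratr_nat -rmorphM ler_rat.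
pose X := cfclass_Iirr L i0; pose Y := cfclass_Iirr L (conjC_Iirr i0).
have cardX (i : Iirr P) : i != 0 -> #|cfclass_Iirr L i| = e.
  by move=> nzi; rewrite card_cfclass_Iirr // (inertia_Frobenius_ker frobLk nzi).
have zcl (i j : Iirr P) : j \in cfclass_Iirr L i -> z j = z i.
  case/imsetP=> y Ly ->; apply: (@intr_inj algC); rewrite -!Dz conjg_IirrE.
  rewrite /psi -(cfResRes _ sPL sLG) cfdot_Res_conjg //.
have Acl (i j : Iirr P) : j \in cfclass_Iirr L i -> i \in A -> j \in A.
  by case/imsetP=> y Ly ->; rewrite !inE conjg_IirrE; apply: cfConjg_lin_char.
have nz_ci : conjC_Iirr i0 != 0 by rewrite conjC_Iirr_eq0.
have A0 : i0 \in A by rewrite inE.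
have Ac : conjC_Iirr i0 \in A by rewrite inE conjC_IirrE cfAut_lin_char.
have z1 : z i0 = z (conjC_Iirr i0) + 1.
  apply: (@intr_inj algC); rewrite rmorphD /= -!Dz; apply/eqP.
  rewrite -subr_eq0 opprD addrA -cfdotBr /psi cfdot_Res_l -(cfIndInd _ sLG sPL).
  rewrite linearB /= -conj_zeta Dchi cfdotBr cfnorm_irr -conjC_IirrE cfdot_irr.
  by rewrite (eq_sym c) (negPf ncc) subr0 subrr.
have := @sum_deviation rat _ A X Y z s (z (conjC_Iirr i0)).
rewrite !cardX // oA => -> //.
- by apply/subsetP=> i Xi; apply: Acl Xi A0.
- by apply/subsetP=> i Yi; apply: Acl Yi Ac.
- by move=> i Xi; rewrite (zcl _ _ Xi).
- by move=> i Yi; rewrite (zcl _ _ Yi).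
Qed.

Lemma exc_own_proof : (#|G| * (m - e))%:R
      <= m%:R * \sum_(x in order_class G p) `|'chi_c x| ^+ 2.
Proof.
rewrite order_classE (sum_class_support_TI tiP); last first.
  by move=> x g _ Gg; rewrite cfunJ.
have h0 : h%:R != 0 :> algC := neq0CG P.
have := exc_Res_norm; set T := \sum_(x in _) _ => le_T.
have -> : (#|G| * (m - e) = (#|G : L|%g * h) * (e * (m - e)))%N.
  by rewrite -(Lagrange sLG) -(Lagrange sPL) (mulnC (h * e)%N) !mulnA.
rewrite natrM; apply: le_trans (ler_wpM2l (ler0n _ _) le_T) _.
by rewrite mulrCA ler_wpM2l ?ler0n // natrM -mulrA mulVKf.
Qed.

Lemma exceptional_proof : exceptional p e m ('Ind[G] alpha0) c.
Proof.
have dot_alpha_beta : '['Ind[G] alpha0, 'chi_c - ('chi_c)^*%CF] = -1.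
  by rewrite -Dchi (cfdot_Ind_TI tiP sAL).
have Z1 : 'Ind[L, P] 1 \in 'Z[irr L] by rewrite cfInd_vchar ?cfun1_vchar.
have Zz : zeta \in 'Z[irr L] by have /irrP[k ->] := irr_zeta; apply: irr_vchar.
split=> //.
- by rewrite cfInd_vchar // rpredB.
- exact: Ind_class_on.
- rewrite (cfdot_Ind_TI tiP sAL) // cfnormBd; last first.
    by rewrite dot_Ind1 (negPf nz_i0) mulr0.
  have := dot_Ind1 0; rewrite irr0 eqxx mulr1 => ->.
  by rewrite norm_zeta mulrSr.
- rewrite -cfdot_Res_r cfRes_cfun1 // cfdotBl -!cfdot_Res_r cfRes_cfun1 // cfnorm1.
  by rewrite -irr0 cfdot_irr (negPf nz_i0) subr0.
- transitivity ('Ind[G] (- beta)); last by rewrite linearN /= Dchi opprB.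
  rewrite cfAutInd -[LHS]linearB; congr ('Ind[G] _).
  have real1: ('Ind[L, P] 1)^*%CF = 'Ind[L, P] 1 by rewrite cfAutInd rmorph1.
  by rewrite rmorphB /= real1 !opprB addrC addrA subrK.
- by rewrite -Dchi Ind_class_on.
- exact: exc_aut_proof.
- exact: exc_own_proof.
- exact: exc_bound_proof.
- exact: exc_card_proof.
- exact: exc_index_proof.
- exact: exc_lin_proof.
Qed.

End Exceptional.

Lemma exceptional_exists (gT : finGroupType) (G : {group gT}) (p : nat) :
    prime_orders G -> simple G -> smaller_classified #|G| -> odd #|G| ->
    ~~ p.-group G -> prime p -> (p %| #|G|)%N ->
  exists d : 'CF(G) * Iirr G * nat * nat,
    exceptional p d.1.2 d.2 d.1.1.1 d.1.1.2.
Proof.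
move=> poG simG smallG oddG notpG p_pr p_dv.
have [P sylP] := Sylow_exists p G.
have ntP: P :!=: 1%g.
  by rewrite -cardG_gt1 (card_Hall sylP) p_part_gt1 mem_primes p_pr cardG_gt0.
have [C frobL oC] := Sylow_norm_Frobenius poG simG smallG notpG sylP ntP.
have [i0 nz_i0 lin_i0]: exists2 i : Iirr P, i != 0 & 'chi_i \is a linear_char.
  have ltP'P: P^`(1)%g \proper P.
    by rewrite (sol_der1_proper (pgroup_sol (pHall_pgroup sylP))) ?subxx.
  have: (1 < #|[pred i | 'chi[P]_i \is a linear_char]|)%N.
    by rewrite card_lin_irr indexg_gt1 proper_subn.
  rewrite (cardD1 0) inE irr0 cfun1_lin_char ltnS => /card_gt0P[i /andP[nzi lin_i]].
  by exists i.
have [c Dchi ncc] := exc_char_exists poG simG smallG oddG notpG sylP ntP frobL oC nz_i0 lin_i0.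
exists ('Ind[G] ('Ind['N_G(P)%G, P] 1 - 'Ind['N_G(P)%G] 'chi_i0), c,
        #|'N_G(P)%G : P|%g, #|P : P^`(1)|%g).
exact: (exceptional_proof poG simG smallG oddG notpG sylP ntP frobL oC nz_i0 lin_i0 Dchi ncc).
Qed.

Section ExceptionalPair.

Variables (gT : finGroupType) (G : {group gT}).
Hypothesis oddG : odd #|G|.

Lemma cfdot_disjoint_orders (j k : nat) (phi psi : 'CF(G)) :
    j != k -> phi \in 'CF(G, order_class G j) -> psi \in 'CF(G, order_class G k) ->
  '[phi, psi] = 0.
Proof.
move=> ne_jk Jphi Kpsi; rewrite (cfdotElr Jphi Kpsi) big_pred0 ?mulr0 // => x.
apply/negP=> /setIP[]; rewrite !inE => /andP[_ /eqP->] /andP[_ jk].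
by rewrite jk in ne_jk.
Qed.

Lemma int_sqr_ge1 (a : algC) : a \in Num.int -> a != 0 -> 1 <= `|a| ^+ 2.
Proof. by move=> Za nza; rewrite intr_normK // sqr_intr_ge1. Qed.

Section Pair.

Variables (j ej mj k ek mk : nat) (aj ak : 'CF(G)) (cj ck : Iirr G).
Hypotheses (ne_jk : j != k) (j_pr : prime j) (k_pr : prime k).
Hypotheses (Ej : exceptional j ej mj aj cj) (Ek : exceptional k ek mk ak ck).

Lemma exceptional_dot_diff : '[ak, 'chi_cj] = '[ak, ('chi_cj)^*%CF].
Proof.
apply/eqP; rewrite -subr_eq0 -cfdotBr.
rewrite (@cfdot_disjoint_orders k j) ?(exc_on Ek) ?(exc_diff_on Ej) //.
by rewrite eq_sym.
Qed.

Lemma exceptional_neq : cj != ck /\ cj != conjC_Iirr ck.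
Proof.
have := cfdot_disjoint_orders ne_jk (exc_diff_on Ej) (exc_diff_on Ek).
rewrite -!conjC_IirrE cfdotBl !cfdotBr !cfdot_irr.
rewrite !(inj_eq (can_inj (@conjC_IirrK _ G))).
have -> : (conjC_Iirr cj == ck) = (cj == conjC_Iirr ck).
  by rewrite -(inj_eq (can_inj (@conjC_IirrK _ G))) conjC_IirrK.
have [-> | ne_c] := eqVneq cj ck.
  rewrite eq_sym (negPf (exc_neq Ek)) subr0 sub0r opprK => /eqP.
  by rewrite paddr_eq0 ?oner_eq0.
have [_ /eqP | //] := eqVneq cj (conjC_Iirr ck).
by rewrite subr0 sub0r -opprD oppr_eq0 paddr_eq0 ?oner_eq0.
Qed.

Lemma exceptional_parity : '[ak, 'chi_cj] != 0 \/ '[aj, 'chi_ck] != 0.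
Proof.
have [ne_c ne_cc] := exceptional_neq.
have real (i e m : nat) (a : 'CF(G)) (c : Iirr G) : exceptional i e m a c ->
    ((a + 'chi_c)^*)%CF = a + 'chi_c.
  move=> Ei; rewrite rmorphD /=; apply/eqP; rewrite -subr_eq0 opprD addrACA.
  by rewrite -(exc_real Ei) addrA subrK subrr.
have Z (i e m : nat) (a : 'CF(G)) (c : Iirr G) : exceptional i e m a c -> a + 'chi_c \in 'Z[irr G].
  by move=> Ei; rewrite rpredD ?(exc_vchar Ei) ?irr_vchar.
have dot1 (i e m : nat) (a : 'CF(G)) (c : Iirr G) : exceptional i e m a c -> '[a + 'chi_c, 1] = 1.
  move=> Ei; rewrite cfdotDl (exc_dot1 Ei) -irr0 cfdot_irr.
  case: eqP => [c0 | _]; last by rewrite addr0.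
  by have := exc_neq Ei; rewrite c0 conjC_Iirr0 eqxx.
have [z Zz] := cfdot_real_vchar_parity oddG (Z _ _ _ _ _ Ej) (Z _ _ _ _ _ Ek)
  (real _ _ _ _ _ Ej) (real _ _ _ _ _ Ek).
rewrite (dot1 _ _ _ _ _ Ej) (dot1 _ _ _ _ _ Ek) mulr1 cfdotDl !cfdotDr.
rewrite (cfdot_disjoint_orders ne_jk (exc_on Ej) (exc_on Ek)) cfdot_irr.
rewrite (negPf ne_c) add0r addr0 (cfdotC 'chi_cj).
have [-> | ] := eqVneq ('[ak, 'chi_cj]) 0; last by left.
have [-> | ] := eqVneq ('[aj, 'chi_ck]) 0; last by right.
rewrite conjC0 addr0 => /esym/eqP; case/intrP: Zz => n ->.
rewrite -mulr_natr -[1]/(1%:~R) -[2%:R]/(2%:~R) -intrM -intrD intr_eq0 => /eqP.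
lia.
Qed.

Lemma exceptional_values x : x \in order_class G k ->
  'chi_cj x \in Num.int /\ exists2 z, z \in Num.int & 'chi_cj 1%g = 'chi_cj x + k%:R * z.
Proof.
case/setIdP=> Gx /eqP ox; apply: (char_prime_rational (irr_char _) Gx k_pr ox).
rewrite -ox; apply: (irr_aut_rational (k := j)) => //.
- exact: exc_neq Ej.
- by rewrite ox.
- by rewrite ox.
exact: exc_aut Ej.
Qed.

(* If k divides chi(1), all values of chi on elements of order k are multiples
   of k, and the integer '[alpha, chi] != 0 forces enough of them to be nonzero;
   otherwise no value vanishes. *)
Lemma exceptional_sum_ge : '[ak, 'chi_cj] != 0 ->
  #|order_class G k|%:R <= \sum_(x in order_class G k) `|'chi_cj x| ^+ 2.
Proof.
move=> nz_dot; have [d Dd] := natrP (Cnat_irr1 cj).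
have [k_dv | k'd] := boolP (k %| d)%N; last first.
  rewrite -sumr_const; apply: ler_sum => x Cx.
  have [Zx [z Zz Dz]] := exceptional_values Cx; apply: int_sqr_ge1 => //.
  apply: contra k'd => /eqP x0; rewrite x0 add0r Dd in Dz.
  case/intrP: Zz Dz => n ->; rewrite -[d%:R]/(d%:Z%:~R) -[k%:R]/(k%:Z%:~R) -intrM.
  by move/intr_inj/(congr1 absz); rewrite abszM /= => ->; rewrite dvdn_mulr.
have le_chi x : x \in order_class G k -> k%:R * `|'chi_cj x| <= `|'chi_cj x| ^+ 2.
  move=> Cx; have [Zx [z Zz Dz]] := exceptional_values Cx.
  have [-> | nzx] := eqVneq ('chi_cj x) 0; first by rewrite normr0 mulr0 expr0n.
  rewrite expr2 ler_wpM2r //.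
  have [n Dn]: exists2 n, n \in Num.int & 'chi_cj x = k%:R * n.
    case/dvdnP: k_dv => q Dq; exists (q%:R - z); first by rewrite rpredB ?rpred_nat.
    by rewrite mulrBr -natrM mulnC -Dq -Dd Dz addrK.
  move=> Dx; rewrite Dx normrM normr_nat ler_peMr ?ler0n //.
  rewrite norm_intr_ge1 //; apply: contraNneq nzx => n0.
  by rewrite Dx n0 mulr0.
have Zdot : '[ak, 'chi_cj] \in Num.int by rewrite Cint_cfdot_vchar_irr ?(exc_vchar Ek).
have [e2 _] := exc_index Ek.
have le_G : #|G|%:R <= (2 * ek)%:R * \sum_(x in order_class G k) `|'chi_cj x|.
  have : 1 <= `|'[ak, 'chi_cj]| by rewrite norm_intr_ge1.
  rewrite (cfdotEl _ (exc_on Ek)) normrM normfV normr_nat.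
  rewrite mulrC ler_pdivlMr ?gt0CG // mul1r => /le_trans; apply.
  rewrite mulr_sumr (le_trans (ler_norm_sum _ _ _)) // ler_sum // => x _.
  by rewrite normrM norm_conjC ler_wpM2r ?(exc_bound Ek).
set T := \sum_(x in _) _ ^+ 2; set U := \sum_(x in _) _ in le_G.
have le_UT : k%:R * U <= T by rewrite mulr_sumr; apply: ler_sum.
have U0 : 0 <= U by apply: sumr_ge0.
have : (ek * #|order_class G k|)%:R <= ek%:R * T.
  apply: le_trans (_ : #|G|%:R <= _); first by rewrite ler_nat ltnW ?(exc_card Ek).
  apply: le_trans le_G _; rewrite mulnC natrM -mulrA ler_wpM2l ?ler0n //.
  by apply: le_trans le_UT; rewrite ler_wpM2r // ler_nat prime_gt1.
by rewrite natrM ler_pM2l // ltr0n; apply: leq_trans e2.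
Qed.

End Pair.

End ExceptionalPair.

Section WeightBound.

Local Open Scope nat_scope.

(* Dividing by g, the hypotheses give
   1 < e / m + 1 / e + (e - 1) / (2 E). *)
Lemma weight_bound (g X s Y i e m E : nat) :
    g = X + s + Y -> m * X <= g * e -> e * s < g -> E * Y <= i * g ->
    2 * i + 1 <= e ->
  2 * m * e * E < 2 * e * e * E + 2 * m * E + e * m * (e - 1) \/ E = 0 \/ m = 0.
Proof.
move=> Dg le_X lt_s le_Y le_i.
have [-> | E0] := posnP E; first by right; left.
have [-> | m0] := posnP m; first by right; right.
left; rewrite ltnNge; apply/negP=> le_E.
have g0 : 0 < g by apply: leq_ltn_trans lt_s.
have e0 : 0 < e by lia.
have h1 : 2 * e * E * (m * X) <= 2 * e * E * (g * e) by rewrite leq_mul2l le_X orbT.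
have h2 : 2 * m * E * (e * s) < 2 * m * E * g by rewrite ltn_pmul2l // !muln_gt0 m0 E0.
have h3 : 2 * e * m * (E * Y) <= e * m * ((e - 1) * g).
  have le_2i : 2 * i <= e - 1 by lia.
  have : e * m * (2 * (E * Y)) <= e * m * (2 * (i * g)) by rewrite leq_mul2l leq_mul2l le_Y !orbT.
  have : e * m * ((2 * i) * g) <= e * m * ((e - 1) * g) by rewrite leq_mul2l leq_mul2r le_2i !orbT.
  rewrite -(mulnA 2 i); lia.
have h4 : (2 * e * e * E + 2 * m * E + e * m * (e - 1)) * g <= 2 * m * e * E * g.
  by rewrite leq_mul2r le_E orbT.
have : 2 * m * e * E * g = 2 * e * E * (m * X) + 2 * m * E * (e * s) + 2 * e * m * (E * Y).
  by rewrite Dg; lia.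
move: h1 h2 h3 h4; lia.
Qed.

Lemma weight_bound4 (g X s Y i e m : nat) :
    2 < e -> (4 * e).+1 <= m ->
    g = X + s + Y -> m * X <= g * e -> e * s < g -> e * Y <= i * g ->
    2 * i + 1 <= e -> False.
Proof.
move=> e2 le_m Dg le_X lt_s le_Y le_i.
have [|[]] := weight_bound Dg le_X lt_s le_Y le_i; [|lia|lia].
case: e e2 le_m {Dg le_X lt_s le_Y le_i} => // e e2 le_m; rewrite subn1 /= => lt_e.
nia.
Qed.

Lemma weight_bound2 (g X s Y i e m E : nat) :
    2 < e -> m = (2 * e).+1 -> e.+2 <= E ->
    g = X + s + Y -> m * X <= g * e -> e * s < g -> E * Y <= i * g ->
    2 * i + 1 <= e -> False.
Proof.
move=> e2 Dm le_E Dg le_X lt_s le_Y le_i.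
have le_Y' : e.+2 * Y <= i * g by apply: leq_trans le_Y; rewrite leq_mul2r le_E orbT.
have [|[]] := weight_bound Dg le_X lt_s le_Y' le_i; [|lia|lia].
case: e e2 Dm {le_E Dg le_X lt_s le_Y le_Y' le_i} => // e e2 ->; rewrite subn1 /=.
nia.
Qed.

End WeightBound.

Section OddSimple.

Variables (gT : finGroupType) (G : {group gT}).
Local Notation primeG k := (prime k && (k %| #|G|)%N).

Lemma sum_order_class (R : nmodType) (F : gT -> R) :
    prime_orders G ->
  \sum_(x in G) F x
    = F 1%g + \sum_(k < #|G|.+1 | primeG k) \sum_(x in order_class G k) F x.
Proof.
move=> poG; rewrite (big_setD1 1%g) //=; congr (_ + _).
have ltG x : x \in G -> (#[x]%g < #|G|.+1)%N by move=> Gx; rewrite ltnS dvdn_leq ?order_dvdG.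
rewrite (partition_big (fun x => inord #[x]%g) (fun k : 'I_#|G|.+1 => primeG k)) /=.
  apply: eq_bigr => k /andP[k_pr _]; apply: eq_bigl => x.
  rewrite !inE; apply/andP/andP=> [[/andP[ntx Gx] /eqP Dk] | [Gx /eqP ox]].
    by rewrite -Dk inordK ?ltG.
  by rewrite -order_gt1 ox prime_gt1 // Gx inord_val.
move=> x G1x; have [_ Gx] := setD1P G1x.
by rewrite inordK ?ltG // (poG x G1x) order_dvdG.
Qed.

Hypotheses (poG : prime_orders G) (simG : simple G).
Hypothesis oddG : odd #|G|.

Variable d : 'I_#|G|.+1 -> 'CF(G) * Iirr G * nat * nat.
Local Notation a k := (d k).1.1.1.
Local Notation c k := (d k).1.1.2.
Local Notation e k := (d k).1.2.
Local Notation m k := (d k).2.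
Local Notation s k := #|order_class G k|.
Hypothesis dP : forall k : 'I_#|G|.+1, primeG k -> exceptional k (e k) (m k) (a k) (c k).

Lemma card_order_class : #|G| = (1 + \sum_(k < #|G|.+1 | primeG k) s k)%N.
Proof.
have := @sum_order_class nat (fun=> 1%N) poG; rewrite sum1_card => DG; apply: (etrans DG).
by congr (_ + _)%N; apply: eq_bigr => k _; rewrite sum1_card.
Qed.

Lemma exceptional_sum_le (j : 'I_#|G|.+1) : primeG j ->
  (m j * (1 + \sum_(k < #|G|.+1 | primeG k && (k != j) && ('[a k, 'chi_(c j)] != 0%R)) s k)
    <= #|G| * e j)%N.
Proof.
move=> Pj; have Ej := dP Pj; have [j_pr _] := andP Pj.
set X := (\sum_(k < _ | _) _)%N; pose F x := `|'chi_(c j) x| ^+ 2.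
have F0 x : 0 <= F x by rewrite exprn_ge0.
have DG : #|G|%:R = \sum_(x in G) F x.
  have := cfnorm_irr (c j); rewrite (cfnormE (cfun_onG _)).
  by move/(canRL (mulVKf (neq0CG G))); rewrite mulr1.
have [e2 _] := exc_index Ej; have [_ m_e] := exc_lin Ej.
have le_em : (e j <= m j)%N by case: m_e; lia.
have leG : 1 + X%:R + \sum_(x in order_class G j) F x <= #|G|%:R.
  rewrite DG sum_order_class // -addrA lerD //.
    rewrite /F -[1](expr1n _ 2) lerXn2r ?nnegrE ?ler01 //.
    have [n Dn] := natrP (Cnat_irr1 (c j)); have := irr1_gt0 (c j).
    by rewrite Dn normr_nat ler1n ltr0n.
  rewrite addrC (bigD1 j) //= lerD2l /X natr_sum.
  rewrite [leRHS](bigID (fun k : 'I_#|G|.+1 => '[a k, 'chi_(c j)] != 0)) /= ler_wpDr //.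
    by apply: sumr_ge0 => k _; apply: sumr_ge0.
  apply: ler_sum => k /andP[/andP[Pk ne_kj] nz]; have [k_pr _] := andP Pk.
  by apply: (exceptional_sum_ge _ j_pr k_pr Ej (dP Pk) nz); rewrite eq_sym.
have : ((m j) * (1 + X) + #|G| * (m j - e j))%:R <= (m j * #|G|)%:R :> algC.
  rewrite natrD; apply: le_trans (lerD (lexx _) (exc_own Ej)) _.
  by rewrite !natrM -mulrDr ler_wpM2l ?ler0n // natrD.
rewrite ler_nat mulnBr => le1.
have le2 : (#|G| * e j <= #|G| * m j)%N by rewrite leq_mul2l le_em orbT.
by move: le1 le2; rewrite (mulnC (m j) #|G|); lia.
Qed.

Lemma exceptional_card_le (j : 'I_#|G|.+1) : primeG j ->
  (2 * #|[set k : 'I_#|G|.+1 | primeG k && (k != j) & '[a j, 'chi_(c k)] != 0%R]| + 1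
     <= e j)%N.
Proof.
move=> Pj; have Ej := dP Pj; have [j_pr _] := andP Pj.
set K := [set k | _ & _].
pose F i := `|'[a j, 'chi[G]_i]| ^+ 2.
have F0 i : 0 <= F i by rewrite exprn_ge0.
have Za i : '[a j, 'chi_i] \in Num.int by rewrite Cint_cfdot_vchar_irr ?(exc_vchar Ej).
have KP k : k \in K -> [/\ primeG k, j != k :> nat & '[a j, 'chi_(c k)] != 0].
  by rewrite inE => /andP[/andP[-> ne_kj] ->]; rewrite eq_sym.
have dotK k : k \in K -> '[a j, 'chi_(conjC_Iirr (c k))] = '[a j, 'chi_(c k)].
  case/KP=> Pk ne_jk _; have [k_pr _] := andP Pk.
  by rewrite conjC_IirrE (exceptional_dot_diff _ (dP Pk) Ej) // eq_sym.
have nz_c (k : 'I_#|G|.+1) : primeG k -> c k != 0.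
  by move=> Pk; apply: contraNneq (exc_neq (dP Pk)) => ->; rewrite conjC_Iirr0.
have neq_c (k l : 'I_#|G|.+1) : primeG k -> primeG l -> k != l :> nat ->
    c k != c l /\ c k != conjC_Iirr (c l).
  by move=> Pk Pl ne_kl; apply: (exceptional_neq ne_kl (dP Pk) (dP Pl)).
pose r := [:: 0, c j, conjC_Iirr (c j) &
  [seq c k | k <- enum K] ++ [seq conjC_Iirr (c k) | k <- enum K]].
have conjI : injective (@conjC_Iirr gT G) := can_inj (@conjC_IirrK _ G).
have cI : {in K &, injective (fun k => c k)}.
  move=> k l /KP[Pk _ _] /KP[Pl _ _]; apply: contra_eq => ne_kl.
  by have [] := neq_c k l Pk Pl ne_kl.
have Ur : uniq r.
  rewrite /r !cons_uniq cat_uniq !(map_inj_in_uniq, enum_uniq) ?andbT; last 2 first.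
  - by move=> k l; rewrite !mem_enum => Kk Kl /conjI; apply: cI.
  - by move=> k l; rewrite !mem_enum; apply: cI.
  rewrite !inE !mem_cat !negb_or ![0 == _]eq_sym conjC_Iirr_eq0 nz_c //=.
  rewrite [c j == _]eq_sym (exc_neq Ej) /=.
  apply/and4P; split.
  - apply/andP; split; apply/mapP=> -[k]; rewrite mem_enum => /KP[Pk _ _] /esym/eqP.
      by rewrite (negPf (nz_c k Pk)).
    by rewrite conjC_Iirr_eq0 (negPf (nz_c k Pk)).
  - apply/andP; split; apply/mapP=> -[k]; rewrite mem_enum => /KP[Pk ne_jk _];
      have [ne ne'] := neq_c j k Pj Pk ne_jk; apply/eqP; by [].
  - apply/andP; split; apply/mapP=> -[k]; rewrite mem_enum => /KP[Pk ne_jk _];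
      have [ne ne'] := neq_c j k Pj Pk ne_jk; last by move/conjI/eqP; apply/negP.
    by move/(canRL (@conjC_IirrK _ G))/eqP; apply/negP.
  apply/hasPn=> i /mapP[k]; rewrite mem_enum => /KP[Pk _ _] {i}->.
  apply/mapP=> -[l]; rewrite mem_enum => /KP[Pl _ _].
  have [eq_kl | ne_kl] := eqVneq (k : nat) l.
    by rewrite (ord_inj eq_kl) => /eqP; rewrite (negPf (exc_neq (dP Pl))).
  have [_ ne'] : c l != c k /\ c l != conjC_Iirr (c k) by apply: neq_c; rewrite // eq_sym.
  by move/esym/eqP; apply/negP.
have le_r : \sum_(i <- r) F i <= (e j).+1%:R.
  rewrite -(exc_norm Ej) cfdot_sum_irr (big_uniq _ Ur) /= [leRHS](bigID (mem r)) /=.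
  apply: ler_wpDr; first by apply: sumr_ge0 => i _; rewrite -normCK exprn_ge0.
  by apply: ler_sum => i _; rewrite -normCK.
have le_K : #|K|%:R <= \sum_(i <- [seq c k | k <- enum K]) F i.
  rewrite big_map big_enum /= -sumr_const; apply: ler_sum => k Kk.
  by have [_ _ nz] := KP k Kk; apply: int_sqr_ge1.
have le_Kc : #|K|%:R <= \sum_(i <- [seq conjC_Iirr (c k) | k <- enum K]) F i.
  rewrite big_map big_enum /= -sumr_const; apply: ler_sum => k Kk.
  by have [_ _ nz] := KP k Kk; apply: int_sqr_ge1; rewrite // dotK.
have le_2 : 1 <= F (c j) + F (conjC_Iirr (c j)).
  have := exc_dot Ej; rewrite cfdotBr -conjC_IirrE.
  have [x0 | nzx] := eqVneq '[a j, 'chi_(c j)] 0.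
    rewrite x0 sub0r => /oppr_inj x1.
    by rewrite ler_wpDl ?F0 // /F x1 normr1 expr1n.
  by rewrite ler_wpDr ?F0 // int_sqr_ge1.
move: le_r; rewrite !big_cons big_cat /= {1}/F irr0 (exc_dot1 Ej) normr1 expr1n => le_r.
have : (1 + (1 + (#|K| + #|K|)))%:R <= (e j).+1%:R :> algC.
  by apply: le_trans le_r; rewrite !natrD lerD // [leRHS]addrA !lerD.
by rewrite ler_nat ltnS addnC mul2n -addnn addnC.
Qed.

Lemma odd_simple_contradiction : False.
Proof.
have [j0 Pj0]: exists j0 : 'I_#|G|.+1, primeG j0.
  have ntG: (1 < #|G|)%N by rewrite cardG_gt1; case/simpleP: simG.
  have pdG := pdiv_dvd #|G|; have pd_lt: (pdiv #|G| < #|G|.+1)%N by rewrite ltnS dvdn_leq.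
  by exists (Ordinal pd_lt); rewrite /= pdiv_prime.
case: (@arg_minnP _ j0 (fun j : 'I_#|G|.+1 => primeG j) (fun j => e j) Pj0) => j Pj min_j.
have bound (i : 'I_#|G|.+1) E : primeG i ->
      (forall k : 'I_#|G|.+1, primeG k -> k != i -> (E <= e k)%N) ->
    exists X Y n, [/\ (#|G| = X + s i + Y)%N, (m i * X <= #|G| * e i)%N,
      (e i * s i < #|G|)%N, (E * Y <= n * #|G|)%N & (2 * n + 1 <= e i)%N].
  move=> Pi leE.
  pose J := fun k : 'I_#|G|.+1 => '[a k, 'chi_(c i)] != 0.
  pose I := [set k : 'I_#|G|.+1 | primeG k && (k != i) & '[a i, 'chi_(c k)] != 0%R].
  exists (1 + \sum_(k < #|G|.+1 | primeG k && (k != i) && J k) s k)%N.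
  exists (\sum_(k < #|G|.+1 | primeG k && (k != i) && ~~ J k) s k)%N, #|I|; split.
  - rewrite [LHS]card_order_class (bigD1 i) //= (bigID J) /=.
    have swap x y z : (1 + (x + (y + z)) = 1 + y + x + z)%N by lia.
    exact: swap.
  - exact: exceptional_sum_le.
  - exact: exc_card (dP Pi).
  - apply: (@leq_trans (\sum_(k in I) #|G|)%N).
      rewrite big_distrr big_mkcond [leqRHS]big_mkcond; apply: leq_sum => k _ /=.
      case: ifP => // /andP[/andP[Pk ne_ki] Jk]; have [i_pr _] := andP Pi; have [k_pr _] := andP Pk.
      rewrite inE Pk ne_ki /=.
      have [nz | nz] := exceptional_parity oddG ne_ki k_pr i_pr (dP Pk) (dP Pi).
        rewrite nz; apply: leq_trans (ltnW (exc_card (dP Pk))).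
        by rewrite leq_mul2r leE ?orbT.
      by rewrite /J nz in Jk.
    by rewrite sum_nat_const.
  - exact: exceptional_card_le.
have [e2 odd_e] := exc_index (dP Pj); have [mj [Dm | le_m]] := exc_lin (dP Pj); last first.
  have [|X [Y [n [h1 h2 h3 h4 h5]]]] := bound j (e j) Pj; first by move=> k Pk _; apply: min_j.
  exact: weight_bound4 e2 le_m h1 h2 h3 h4 h5.
have [/existsP[k /and3P[Pk ne_kj /eqP eq_e]] | no_k] :=
    boolP [exists k : 'I_#|G|.+1, [&& primeG k, k != j & e k == e j]].
  have [k2 _] := exc_index (dP Pk); have [mk [Dmk | le_m]] := exc_lin (dP Pk).
    have [k_pr _] := andP Pk.
    have /eqP : m j = 1%N.
      apply: (pnat_1 mj); rewrite Dm -eq_e -Dmk.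
      by apply: sub_in_pnat mk => i _ /eqnP->; rewrite !inE.
    by rewrite Dm; case: (e j) e2.
  have [|X [Y [n [h1 h2 h3 h4 h5]]]] := bound k (e k) Pk.
    by move=> i Pi _; rewrite eq_e; apply: min_j.
  exact: weight_bound4 k2 le_m h1 h2 h3 h4 h5.
have [|X [Y [n [h1 h2 h3 h4 h5]]]] := bound j (e j).+2 Pj; last first.
  exact: weight_bound2 e2 Dm (leqnn _) h1 h2 h3 h4 h5.
move=> k Pk ne_kj; have := min_j k Pk; rewrite leq_eqVlt => /orP[/eqP eq_e | lt_e].
  by case/existsP: no_k; exists k; rewrite Pk ne_kj eq_e eqxx.
rewrite ltn_neqAle lt_e andbT; have [_ odd_k] := exc_index (dP Pk).
by apply: contraTneq odd_k => <-; rewrite /= odd_e.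
Qed.

End OddSimple.

Theorem odd_simple_pgroup (gT : finGroupType) (G : {group gT}) :
    prime_orders G -> simple G -> smaller_classified #|G| -> odd #|G| ->
  exists2 p, prime p & p.-group G.
Proof.
move=> poG simG smallG oddG.
have ntG : (1 < #|G|)%N by rewrite cardG_gt1; case/simpleP: simG.
have p0_pr : prime (pdiv #|G|) by rewrite pdiv_prime.
have [|not_p0G] := boolP ((pdiv #|G|).-group G); first by exists (pdiv #|G|).
have notpG p : prime p -> ~~ p.-group G.
  move=> p_pr; apply: contra not_p0G => pG.
  by have /eqnP-> : pdiv #|G| \in (p : nat_pred) by apply: (pnatPpi pG); rewrite pi_pdiv.
have [|d dP] := @fin_all_exists _ (fun=> 'CF(G) * Iirr G * nat * nat)%type
  (fun (k : 'I_#|G|.+1) d => prime k && (k %| #|G|)%N ->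
     exceptional k d.1.2 d.2 d.1.1.1 d.1.1.2).
  move=> k; have [/andP[k_pr k_dv] | _] := boolP (prime k && (k %| #|G|)%N); last first.
    by exists (0, 0, 0%N, 0%N).
  have [d dP] := exceptional_exists poG simG smallG oddG (notpG k k_pr) k_pr k_dv.
  by exists d.
by case: (@odd_simple_contradiction _ _ poG simG oddG d dP).
Qed.

End OddOrder.

(** * Classification *)

Theorem prime_orders_classified (gT : finGroupType) (G : {group gT}) :
  prime_orders G -> classified G.
Proof.
move: {2}#|G|.+1 (ltnSn #|G|) => n; elim: n gT G => // n IHn gT G leGn poG.
have smallG : smaller_classified #|G|.
  by move=> rT K ltKG; apply: IHn; apply: leq_trans ltKG _.
have [simG | nsimG] := boolP (simple G); last exact: classified_not_simple.
have [evenG | oddG] := boolP (2 %| #|G|); last first.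
  constructor 1; apply: odd_simple_pgroup poG simG smallG _.
  by rewrite dvdn2 negbK in oddG.
have [twoG | not2G] := boolP (2.-group G); first by constructor 1; exists 2.
have [S sylS] := Sylow_exists 2 G.
have [oG iG] := even_simple_order poG simG smallG evenG not2G sylS.
by constructor 3; split=> //; exists 'N_G(S)%G; rewrite ?subsetIl.
Qed.

Lemma simple_index5_isog_Alt (gT : finGroupType) (G H : {group gT}) :
    simple G -> #|G| = 60 -> H \subset G -> #|G : H| = 5 ->
  G \isog 'Alt_('I_5).
Proof.
move=> simG oG sHG iH; set S := rcosets H G in iH.
pose A := <[actsRs_rcosets H G]>%act.
have sA C x : C \in S -> A C x \in S.
  rewrite /= /actby; case: ifP => // /andP[SC Gx] _.
  by rewrite (acts_act (actsRs_rcosets H G)).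
have S_H : gval H \in S by apply/rcosetsP; exists 1; rewrite ?mulg1.
pose f (i : 'I_5) : {set gT} := enum_val (cast_ord (esym iH) i).
pose g C : 'I_5 := cast_ord iH (enum_rank_in S_H C).
have fK : cancel f g by move=> i; rewrite /g /f enum_valK_in cast_ordKV.
have gK : {in S, cancel g f} by move=> C SC; rewrite /g /f cast_ordK enum_rankK_in.
have fS i : f i \in S by apply: enum_valP.
have act_to : is_action G (fun i x => g (A (f i) x)).
  split=> [x i j /(congr1 f) | i x y Gx Gy /=].
    by rewrite !gK ?sA // => /act_inj/(can_inj fK).
  by rewrite gK ?sA // actMin.
pose phi := actperm_morphism (Action act_to).
have inj_phi : 'injm phi.
  have [_ simG'] := simpleP _ simG.
  case: (simG' _ (ker_normal phi)) => [-> // | kerG].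
  suffices : G \subset H by rewrite -indexg_eq1 iH.
  apply/subsetP=> x Gx; have : x \in 'ker phi by rewrite kerG.
  move/mker => /(congr1 (fun s : {perm 'I_5} => f (s (g H)))).
  rewrite permE /= perm1 !gK ?sA // actbyE //= => DH.
  by have := rcoset_refl H x; rewrite -rcosetE DH.
have oK : #|phi @* G| = 60 by rewrite card_injm.
have oSym : #|'Sym_('I_5)| = 120 by rewrite card_Sym card_ord.
have oAlt : #|'Alt_('I_5)| = 60.
  by apply/eqP; rewrite -(@eqn_pmul2l 2) // card_Alt card_ord.
apply: isog_trans (sub_isog (subxx G) inj_phi) _.
have simK : simple (phi @* G) by rewrite -(isog_simple (sub_isog (subxx G) inj_phi)).
have [_ simK'] := simpleP _ simK.
have nsKA : phi @* G :&: 'Alt_('I_5) <| phi @* G.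
  exact: normalGI (subsetT _) (Alt_normal _).
have [KA1 | KA] := simK' _ nsKA.
  have := max_card (mem (phi @* G * 'Alt_('I_5))).
  by rewrite TI_cardMg // oK oAlt -[#|_|]cardsT [#|_|]oSym.
have /eqP : phi @* G == 'Alt_('I_5).
  by rewrite eqEcard oK oAlt andbT; apply/setIidPl; rewrite -[RHS]KA.
by rewrite /= => ->; apply: isog_refl.
Qed.

Section Main.

Variables (gT : finGroupType) (G : {group gT}).
Local Notation N := <<Gminus G>>.

Lemma GminusP x :
  reflect (x \in G /\ exists2 y, y \in G & <[x]> \proper <[y]>) (x \in Gminus G).
Proof.
rewrite inE; apply: (iffP andP) => -[Gx].
  move=> nmax; split=> //; apply/exists_inP; apply: contraR nmax => no_y.
  apply/maxgroupP; split=> [|D /andP[sDG /cyclicP[y Dy]] sxD].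
    by rewrite cycle_subG Gx cycle_cyclic.
  apply/eqP; rewrite eqEsubset sxD andbT; apply: contraR no_y => nsDx.
  apply/exists_inP; exists y; last by rewrite -Dy properE sxD.
  by rewrite (subsetP sDG) // Dy cycle_id.
case=> y Gy /andP[sxy nsyx]; split=> //; apply/negP=> /maxgroupP[_ /(_ <[y]>%G)].
by rewrite /= cycle_subG Gy cycle_cyclic => /(_ isT sxy) Dy; rewrite Dy subxx in nsyx.
Qed.

Lemma Gminus_norm : G \subset 'N(Gminus G).
Proof.
apply/subsetP=> z Gz; rewrite inE; apply/subsetP=> _ /imsetP[x /GminusP[Gx [y Gy ltxy]] ->].
by apply/GminusP; rewrite groupJ //; split=> //; exists (y ^ z); rewrite ?groupJ // !cycleJ properJ.
Qed.

Lemma quotient_prime_orders : prime_orders (G / N).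
Proof.
move=> y /setD1P[nty /morphimP[x Nx Gx Dy]].
have notNx : x \notin N by apply: contra nty => Nx'; rewrite Dy /= coset_id.
have ntx : x != 1 by apply: contraNneq notNx => ->; apply: group1.
pose p := pdiv #[x]; have p_pr : prime p by rewrite pdiv_prime ?order_gt1.
have xpN : x ^+ p \in N.
  apply/mem_gen/GminusP; rewrite groupX //; split=> //; exists x => //.
  rewrite properEcard cycleX -!orderE orderXdiv ?pdiv_dvd //.
  by rewrite ltn_Pdiv ?prime_gt1.
suffices /(prime_nt_dvdP p_pr) -> : #[y] %| p by rewrite ?order_eq1.
by rewrite order_dvdn Dy -morphX //= coset_id.
Qed.

End Main.

Lemma prime_orders_exponent (gT : finGroupType) (G : {group gT}) (p : nat) :
  prime_orders G -> p.-group G -> prime p -> G :!=: 1 -> exponent G = p.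
Proof.
move=> poG pG p_pr ntG; apply/prime_nt_dvdP; rewrite -?dvdn1 -?trivg_exponent //.
apply/exponentP=> x Gx; have [-> | ntx] := eqVneq x 1; first by rewrite expg1n.
apply/eqP; rewrite -order_dvdn.
have ox : prime #[x] by apply: poG; apply/setD1P.
by have /eqnP-> : #[x] \in (p : nat_pred) by rewrite -pnatE //; apply: mem_p_elt pG Gx.
Qed.

Theorem theorem1p1 (gT : finGroupType) (G : {group gT}) :
  let N := <<Gminus G>> in
  N \proper G ->
  [\/ exists p : nat, [/\ prime p, p.-group (G / N) & exponent (G / N) = p],
      exists (p q : nat) (K H : {group coset_of N}),
        [/\ prime p, prime q, p != q,
            [Frobenius G / N = K ><| H]
          & [/\ p.-group K, exponent K = p & #|H| = q]]
    | (G / N) \isog 'Alt_('I_5)].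
Proof.
move=> N /andP[_ nsGN].
have nNG : G \subset 'N(N) by apply: norms_gen (Gminus_norm G).
have ntGN : G / N != 1 by rewrite -subG1 quotient_sub1.
have poGN : prime_orders (G / N)%G := @quotient_prime_orders _ G.
have [[p p_pr pGN] | [p [q [K [H [p_pr q_pr ne_pq frobG [pK oH]]]]]] | [simGN oGN [H sH iH]]]
    := prime_orders_classified poGN.
- by constructor 1; exists p; split=> //; apply: (@prime_orders_exponent _ (G / N)%G).
- constructor 2; exists p, q, K, H; split=> //; split=> //.
  have [defG ntK _ _ _] := Frobenius_context frobG.
  have [/andP[sKG _] _ _ _ _] := sdprod_context defG.
  by apply: prime_orders_exponent ntK => //; apply: prime_ordersS poGN.
by constructor 3; apply: (@simple_index5_isog_Alt _ (G / N)%G H).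
Qed.
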